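(* Let $X$ be a zero-dimensional first-countable space containing at least two points. Then the following are equivalent. (1) $X^\omega\cong (X\oplus 1)^\omega$. (2) $X^\omega\cong Y^\omega$ for some space $Y$ with at least one isolated point. (3) $X^\omega$ is h-homogeneous. (4) $X^\omega$ has a non-empty clopen subset that is strongly divisible by $2$. (5) $X^\omega$ has a proper clopen subset that is homeomorphic to $X^\omega$. (6) $X^\omega$ has a proper clopen subset that is a factor of $X^\omega$.
   Context: All spaces are assumed to be Tychonoff. Powers carry the product topology; $\cong$ means homeomorphic; $\oplus$ is the topological disjoint sum; $1=\{0\}$ is the one-point space and $2=\{0,1\}$ is the two-point discrete space. A subset of a space is clopen if it is closed and open (subsets are regarded as subspaces); a proper subset is one different from the whole space. A space is zero-dimensional if it has a base consisting of clopen sets. A space is h-homogeneous if all of its non-empty clopen subsets are homeomorphic to each other. A space $F$ is a factor of a space $Z$ (equivalently, $Z$ is divisible by $F$) if there exists a space $W$ such that $F\times W\cong Z$. If $F\times Z\cong Z$, then $F$ is a strong factor of $Z$ (equivalently, $Z$ is strongly divisible by $F$). *)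

(* Defs.v *)
From mathcomp Require Import all_boot all_order all_algebra.
From mathcomp Require Import all_classical all_reals.
From mathcomp Require Import topology urysohn.

Set Implicit Arguments.
Unset Strict Implicit.
Unset Printing Implicit Defensive.

Local Open Scope classical_set_scope.

(* [completely_regular_space] of the library does not include T1. *)
Definition tychonoff_space (T : topologicalType) : Prop :=
  completely_regular_space T /\ accessible_space T.

(* The library's [zero_dimensional] only asks that distinct points be separated
   by clopen sets, which is weaker than having a base of clopen sets. *)
Definition zero_dimensional_space (T : topologicalType) : Prop :=
  exists2 B : set (set T), basis B & B `<=` clopen.

Definition first_countable_space (T : topologicalType) : Prop :=
  forall x : T, exists B : set (set T),
    [/\ countable B, B `<=` nbhs x &
        forall U, nbhs x U -> exists2 V, B V & V `<=` U].

Definition homeomorphic (S T : topologicalType) : Prop :=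
  exists (f : S -> T) (g : T -> S),
    [/\ cancel f g, cancel g f, continuous f & continuous g].

(* Subsets are regarded as spaces through [set_type], which carries the initial
   topology of the inclusion; the library's [subspace] keeps the points outside
   the set as isolated points and is not the subspace meant here. *)
Definition h_homogeneous (T : topologicalType) : Prop :=
  forall A B : set T, clopen A -> A !=set0 -> clopen B -> B !=set0 ->
    homeomorphic (set_type A) (set_type B).

Definition is_factor (F Z : topologicalType) : Prop :=
  exists2 W : topologicalType,
    tychonoff_space W & homeomorphic (F * W)%type Z.

Definition is_strong_factor (F Z : topologicalType) : Prop :=
  homeomorphic (F * Z)%type Z.

Definition omega_power (X : topologicalType) : topologicalType :=
  {ptws nat -> X}.

Definition disjoint_sum (X Y : topologicalType) : topologicalType :=
  {b : bool & (if b return topologicalType then X else Y)}.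

Definition one_point_space : topologicalType := discrete_topology unit.

(* [bool] carries the discrete topology in the library. *)
Definition two_point_space : topologicalType := bool.

(* Main.v *)
(* The implications avoid the Dow-Pearl homogeneity theorem.  Their core is that
   if Y is zero-dimensional and first-countable with an isolated point z, then
   U x Y^w is homeomorphic to Y^w for every non-empty clopen U missing z
   ([factor_absorb]).  Take a decreasing clopen base P_0 = U, P_1, ... at a point
   p of U and put Q_n = P_n \ P_(n+1).  The homeomorphism
   phi_l : Y^w -> P_l x Y^w reads x = z^i y x' with y <> z: if y is in Q_(l+i), it
   is moved to the front, phi_l(x) = (y, z^i x'); otherwise
   phi_l(x) = (a, z^d y v) where (a, v) = phi_(l+d+1)(x'), with d = i - 1 if y is
   in P_l \ P_(l+i) and d = i if not.  If the recursion never stops, the first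
   coordinate is the limit p.
   Hence Y^w has a base of clopen boxes homeomorphic to Y^w.  Since Y^w consists
   of the point z^w and pieces converging to it, shifting those pieces shows that
   Y^w absorbs any clopen subset ([swindle], [absorb_clopen]), so Y^w is
   h-homogeneous.
   For (6) => (1), let T = X^w, let C be a proper clopen factor of T and D its
   complement.  Then C x T = T, so (D + 1) x T = D x T + C x T = T, whence
   (D + 1)^w x T = T; since (D + 1)^w absorbs D, this gives 2 x T = T.  Therefore
   (X + 1) x T = T + T = T, so T = (X + 1)^w x X^w = (X + 1)^w. *)
Require Import Defs.
From mathcomp Require Import all_boot all_order all_algebra.
From mathcomp Require Import all_classical all_reals.
From mathcomp Require Import topology urysohn.

Set Implicit Arguments.
Unset Strict Implicit.
Unset Printing Implicit Defensive.

Local Open Scope classical_set_scope.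

(** * Pointwise continuity and clopen sets *)

Lemma continuous_near_eq (S T : topologicalType) (f g : S -> T) (x : S) :
  {near x, f =1 g} -> {for x, continuous g} -> {for x, continuous f}.
Proof.
move=> fg cg; have fgx := nbhs_singleton fg.
rewrite /prop_for /continuous_at fgx.
by apply: cvg_trans cg; apply: near_eq_cvg; apply: filterS fg => y /= ->.
Qed.

Lemma continuous_compose (R S T : topologicalType) (f : R -> S) (g : S -> T) x :
  {for x, continuous f} -> {for f x, continuous g} ->
  {for x, continuous (fun y => g (f y))}.
Proof. exact: continuous_comp. Qed.

Lemma continuous_pair (R S T : topologicalType) (f : R -> S) (g : R -> T) x :
  {for x, continuous f} -> {for x, continuous g} ->
  {for x, continuous (fun y => (f y, g y))}.
Proof. by move=> cf cg; exact: cvg_pair. Qed.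

Lemma near_preimage (S T : topologicalType) (f : S -> T) (x : S) (A : set T) :
  {for x, continuous f} -> nbhs (f x) A -> \forall y \near x, A (f y).
Proof. by move=> cf nA; exact: cf. Qed.

Lemma clopen_near (T : topologicalType) (A : set T) (x : T) :
  clopen A -> \forall y \near x, A y <-> A x.
Proof.
move=> [oA cA]; have [Ax|nAx] := pselect (A x).
  by apply: filterS (open_nbhs_nbhs (conj oA Ax)) => y Ay; split.
have := open_nbhs_nbhs (conj (closed_openC cA) nAx).
by apply: filterS => y nAy; split=> // /nAy.
Qed.

Lemma clopenD (T : topologicalType) (A B : set T) :
  clopen A -> clopen B -> clopen (A `\` B).
Proof. by move=> cA cB; apply: clopenI => //; exact: (@clopenC _ _ set0). Qed.

(** * Boxes and neighbourhoods in a countable power *)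

Section OmegaPower.
Variable X : topologicalType.

Lemma coord_continuous (n : nat) : continuous (fun x : omega_power X => x n).
Proof. exact: (@proj_continuous nat (fun=> X) n). Qed.

Lemma omega_continuous (S : topologicalType) (f : S -> omega_power X) (s : S) :
  (forall n, {for s, continuous (fun t => f t n)}) -> {for s, continuous f}.
Proof.
move=> cf; apply/cvg_sup => n A [_ [[B oB <-] Bs] /filterS]; apply.
by apply: cf; exact: open_nbhs_nbhs.
Qed.

Definition box (n : nat) (V : nat -> set X) : set (omega_power X) :=
  [set x | forall j, (j < n)%N -> V j (x j)].

Lemma nbhs_box (n : nat) (V : nat -> set X) (x : omega_power X) :
  (forall j, (j < n)%N -> nbhs (x j) (V j)) -> nbhs x (box n V).
Proof.
elim: n => [|n IH] nV; first by apply: filterS filterT.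
have /IH bV : forall j, (j < n)%N -> nbhs (x j) (V j).
  by move=> j jn; apply: nV; exact: ltnW.
have := near_preimage (@coord_continuous n x) (nV _ (ltnSn n)).
apply: filterS2 bV => y By Vy j; rewrite ltnS leq_eqVlt => /orP[/eqP->//|].
exact: By.
Qed.

(** The boxes around [x] generate a filter. It converges to [x] because each subbasic neighbourhood
    contains a box, so it refines the neighbourhood filter. *)
Lemma nbhs_boxP (x : omega_power X) (A : set (omega_power X)) :
  nbhs x A -> exists n V, (forall j, nbhs (x j) (V j)) /\ box n V `<=` A.
Proof.
pose I := (nat * (nat -> set X))%type.
pose D : set I := [set i | forall j, nbhs (x j) (i.2 j)].
pose F := filter_from D (fun i => box i.1 i.2).
have FF : Filter F.
  apply: filter_from_filter; first by exists (0%N, fun=> setT) => j; exact: filterT.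
  move=> [n V] [m W] /= nV nW; exists (maxn n m, fun j => V j `&` W j).
    by move=> j /=; apply: filterI; [exact: nV | exact: nW].
  move=> y /= By; split=> j jn /=.
    by have /By [] : (j < maxn n m)%N by rewrite leq_max jn.
  by have /By [] : (j < maxn n m)%N by rewrite leq_max jn orbT.
have : F --> x.
  apply/cvg_sup => n B [_ [[C oC <-] Cx] /filterS]; apply.
  exists (n.+1, fun j => if j == n then C else setT).
    move=> j /=; case: eqP => [->|_]; last exact: filterT.
    exact: open_nbhs_nbhs.
  by move=> y /= /(_ n (ltnSn n)); rewrite eqxx.
by move=> /[apply] -[[n V] /= nV sub]; exists n, V.
Qed.

Lemma box_clopen (n : nat) (V : nat -> set X) :
  (forall j, clopen (V j)) -> clopen (box n V).
Proof.
move=> cV; elim: n => [|n IH].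
  by rewrite (_ : box 0 V = setT); [exact: clopenT|apply/seteqP; split].
rewrite (_ : box n.+1 V = box n V `&` ((fun x : omega_power X => x n) @^-1` V n)).
  by apply: clopenI => //; apply: preimage_clopen => //; exact: coord_continuous.
apply/seteqP; split=> [y By|y [By Vy] j].
  by split=> [j jn|]; apply: By => //; exact: ltnW.
by rewrite ltnS leq_eqVlt => /orP[/eqP->//|]; exact: By.
Qed.

End OmegaPower.

(** * Homeomorphisms between subsets *)

(** Total maps, mutually inverse only on [A] and [B], with continuity at their points taken in the
    ambient spaces. For open sets this is the subspace notion, and maps can be restricted and glued
    without subtypes. *)
Definition set_homeo (S T : topologicalType) (A : set S) (B : set T) : Prop :=
  exists (f : S -> T) (g : T -> S),
    [/\ forall x, A x -> [/\ B (f x), g (f x) = x & {for x, continuous f}] &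
        forall y, B y -> [/\ A (g y), f (g y) = y & {for y, continuous g}]].

Lemma set_homeo_refl (S : topologicalType) (A : set S) : set_homeo A A.
Proof. by exists id, id; split=> x Ax; split=> //; exact: cvg_id. Qed.

Lemma set_homeo_sym (S T : topologicalType) (A : set S) (B : set T) :
  set_homeo A B -> set_homeo B A.
Proof. by move=> [f [g [fP gP]]]; exists g, f. Qed.

Lemma set_homeo_trans (R S T : topologicalType) (A : set R) (B : set S) (C : set T) :
  set_homeo A B -> set_homeo B C -> set_homeo A C.
Proof.
move=> [f [g [fP gP]]] [f' [g' [f'P g'P]]].
exists (fun x => f' (f x)), (fun y => g (g' y)); split=> x Ax.
  have [Bx gfx cf] := fP x Ax; have [Cx gfx' cf'] := f'P _ Bx.
  by split=> //; [rewrite gfx' | exact: continuous_compose].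
have [Bx gfx cf] := g'P x Ax; have [Cx gfx' cf'] := gP _ Bx.
by split=> //; [rewrite gfx' | exact: continuous_compose].
Qed.

Lemma homeomorphicP (S T : topologicalType) :
  homeomorphic S T <-> set_homeo [set: S] [set: T].
Proof.
split=> [[f [g [fK gK cf cg]]]|[f [g [fP gP]]]].
  by exists f, g; split=> x _; split=> //; [exact: cf | exact: cg].
exists f, g; split=> x; first by have [] := fP x.
- by have [] := gP x.
- by have [] := fP x.
- by have [] := gP x.
Qed.

Lemma set_homeo_prod (S T S' T' : topologicalType) (A : set S) (B : set T)
    (A' : set S') (B' : set T') :
  set_homeo A B -> set_homeo A' B' -> set_homeo (A `*` A') (B `*` B').
Proof.
move=> [f [g [fP gP]]] [f' [g' [f'P g'P]]].
exists (fun x => (f x.1, f' x.2)), (fun y => (g y.1, g' y.2)).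
split=> -[x x'] [/= Ax Ax'].
  have [Bx gfx cf] := fP x Ax; have [Bx' gfx' cf'] := f'P _ Ax'.
  split=> //=; first by rewrite gfx gfx'.
  apply: continuous_pair.
    by apply: (@continuous_compose _ _ _ fst f) => //; exact: cvg_fst.
  by apply: (@continuous_compose _ _ _ snd f') => //; exact: cvg_snd.
have [Bx gfx cf] := gP x Ax; have [Bx' gfx' cf'] := g'P _ Ax'.
split=> //=; first by rewrite gfx gfx'.
apply: continuous_pair.
  by apply: (@continuous_compose _ _ _ fst g) => //; exact: cvg_fst.
by apply: (@continuous_compose _ _ _ snd g') => //; exact: cvg_snd.
Qed.

Definition glue (S T : Type) (C : set S) (f f' : S -> T) (x : S) : T :=
  if pselect (C x) then f x else f' x.

Lemma glueP (S T : topologicalType) (C C' : set S) (f f' : S -> T) :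
  open C -> open C' -> C `&` C' `<=` set0 ->
  [/\ forall x, C x -> glue C f f' x = f x,
      forall x, C' x -> glue C f f' x = f' x,
      forall x, C x -> {for x, continuous f} ->
        {for x, continuous (glue C f f')} &
      forall x, C' x -> {for x, continuous f'} ->
        {for x, continuous (glue C f f')}].
Proof.
move=> oC oC' CC'.
have hC x : C x -> glue C f f' x = f x by rewrite /glue; case: pselect.
have hC' x : C' x -> glue C f f' x = f' x.
  by rewrite /glue; case: pselect => // Cx C'x; case: (CC' x).
split=> // x Cx; apply: continuous_near_eq.
  by apply: filterS (open_nbhs_nbhs (conj oC Cx)) => y /hC.
by apply: filterS (open_nbhs_nbhs (conj oC' Cx)) => y /hC'.
Qed.

(** Near each point of an open piece the glued map coincides with the map of that piece, so
    continuity is inherited. *)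
Lemma set_homeoU (S T : topologicalType) (A A' : set S) (B B' : set T) :
  open A -> open A' -> open B -> open B' ->
  A `&` A' `<=` set0 -> B `&` B' `<=` set0 ->
  set_homeo A B -> set_homeo A' B' -> set_homeo (A `|` A') (B `|` B').
Proof.
move=> oA oA' oB oB' AA' BB' [f [g [fP gP]]] [f' [g' [f'P g'P]]].
have [hA hA' chA chA'] := glueP f f' oA oA' AA'.
have [hB hB' chB chB'] := glueP g g' oB oB' BB'.
exists (glue A f f'), (glue B g g'); split=> x [Ax|Ax].
- have [Bx gfx cf] := fP x Ax.
  by split; [rewrite hA//; left|rewrite hA// hB|exact: chA].
- have [Bx gfx cf] := f'P x Ax.
  by split; [rewrite hA'//; right|rewrite hA'// hB'|exact: chA'].
- have [Bx gfx cf] := gP x Ax.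
  by split; [rewrite hB//; left|rewrite hB// hA|exact: chB].
- have [Bx gfx cf] := g'P x Ax.
  by split; [rewrite hB'//; right|rewrite hB'// hA'|exact: chB'].
Qed.

(** The image of [A'] is [B] intersected with the preimage of [A'] under [g], as [g] is continuous
    only on [B]. Its complement is open: it is the union of the complement of [B] and the part of
    [B] that [g] sends outside [A']. *)
Lemma set_homeo_sub (S T : topologicalType) (A A' : set S) (B : set T) :
  clopen B -> clopen A' -> A' `<=` A -> set_homeo A B ->
  exists B', [/\ clopen B', B' `<=` B, set_homeo A' B' &
    set_homeo (A `\` A') (B `\` B')].
Proof.
move=> [oB cB] [oA' cA'] AA' [f [g [fP gP]]].
have opre (C : set S) : open C -> open (B `&` g @^-1` C).
  move=> oC; rewrite openE => y [By Cgy]; have [_ _ cg] := gP y By.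
  by apply: filterI; [exact: open_nbhs_nbhs|apply: cg; exact: open_nbhs_nbhs].
exists (B `&` g @^-1` A'); split; last 3 first.
- by move=> y [].
- exists f, g; split=> [x A'x|y [By A'gy]]; last by have [] := gP y By.
  have [Bx gfx cf] := fP x (AA' _ A'x); split=> //.
  by split=> //=; rewrite gfx.
- exists f, g; split=> [x [Ax nA'x]|y [By nB'y]].
    by have [Bx gfx cf] := fP x Ax; split=> //; split=> // -[_]; rewrite /= gfx.
  by have [Ay fgy cg] := gP y By; split=> //; split=> // A'gy; apply: nB'y.
split; first exact: opre.
rewrite -openC (_ : ~` _ = ~` B `|` (B `&` g @^-1` (~` A'))).
  by apply: openU; [exact: closed_openC | apply/opre/closed_openC].
apply/seteqP; split=> y /=.
  move=> nBA; have [By|nBy] := pselect (B y); [right|by left].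
  by split=> // Ay; apply: nBA.
by move=> [nBy [By _]|[_ nA] [_ /nA]].
Qed.

(** The inverse of the inclusion must be total, so points outside [A] go to a base point, whence
    [A !=set0]. Openness of [A] makes it continuous at the points of [A] in the ambient space. *)
Lemma set_homeo_set_type (S : topologicalType) (A : set S) :
  open A -> A !=set0 -> set_homeo [set: set_type A] A.
Proof.
move=> oA [a Aa]; pose a0 : set_type A := SigSub (mem_set Aa).
exists val, (insubd a0); split=> [x _|x Ax].
  split; first exact: set_valP.
    exact: valKd.
  exact: (@initial_continuous _ _ (@set_val _ A)).
have iK y : A y -> val (insubd a0 y) = y.
  by move=> Ay; apply: insubdK; exact: mem_set.
split=> //; first exact: iK.
move=> B [_ [[C oC <-] Cx] sub].
have {}Cx : C x by rewrite -(iK x Ax).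
have := open_nbhs_nbhs (conj oC Cx).
apply: filterS2 (open_nbhs_nbhs (conj oA Ax)) => y Ay Cy; apply: sub.
by rewrite /preimage/= -[set_val _]/(val (insubd a0 y)) iK.
Qed.

(** * Sequences read as a block of [z] followed by a letter and a tail *)

Section Streams.
Variables (Y : topologicalType) (z : Y).
Implicit Types (x : nat -> Y) (i n : nat) (y : Y).

Definition drop_stream i x : nat -> Y := fun n => x (i + n)%N.
Definition pad i x : nat -> Y := fun n => if (n < i)%N then z else x (n - i)%N.
Definition cons_stream y x : nat -> Y := fun n => if n is m.+1 then x m else y.
(** The word [z^i y x]. Every sequence other than the constant [z] has this form with [y <> z] in
    exactly one way. *)
Definition insert i y x : nat -> Y := pad i (cons_stream y x).
Definition padded i x : Prop := forall j, (j < i)%N -> x j = z.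

Definition lead x : option nat :=
  if pselect (exists i, x i != z) is left h then Some (ex_minn h) else None.

Lemma insertE i y x n :
  insert i y x n = if (n < i)%N then z else if n == i then y else x (n - i.+1)%N.
Proof.
rewrite /insert /pad /cons_stream; case: ltngtP => // [ni|->]; last by rewrite subnn.
by rewrite -[(n - i)%N]prednK ?subn_gt0// subnS.
Qed.

Lemma leadN x : lead x = None -> x = fun=> z.
Proof.
rewrite /lead; case: pselect => // h _; apply/funext => n.
by apply/eqP/negP => xn; apply: h; exists n; apply/negP.
Qed.

Lemma lead_cst : lead (fun=> z) = None.
Proof. by rewrite /lead; case: pselect => // -[i]; rewrite eqxx. Qed.

Lemma leadS x i : lead x = Some i -> padded i x /\ x i <> z.
Proof.
rewrite /lead; case: pselect => // h [<-]; case: ex_minnP => m xm min.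
split=> [j jm|]; last exact/eqP.
by apply/eqP/negPn/negP => /min; rewrite leqNgt jm.
Qed.

Lemma lead_padded x i : padded i x -> x i <> z -> lead x = Some i.
Proof.
move=> px /eqP xi; case E : (lead x) => [j|]; last first.
  by move/leadN: E xi => ->; rewrite eqxx.
have [pj xj] := leadS E; congr Some; apply/eqP; rewrite eqn_leq leqNgt.
apply/andP; split; first by apply/negP => /pj /eqP; rewrite (negPf xi).
by rewrite leqNgt; apply/negP => /px.
Qed.

Lemma pad_padded i x : padded i (pad i x).
Proof. by move=> j ji; rewrite /pad ji. Qed.

Lemma insert_padded i y x : padded i (insert i y x).
Proof. exact: pad_padded. Qed.

Lemma insert_at i y x : insert i y x i = y.
Proof. by rewrite insertE ltnn eqxx. Qed.

Lemma drop_insert i y x : drop_stream i.+1 (insert i y x) = x.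
Proof.
apply/funext => n; rewrite /drop_stream insertE addSn ltnNge leqW ?leq_addr//=.
by rewrite gtn_eqF ?ltnS ?leq_addr// subSS addKn.
Qed.

Lemma insert_drop i x : padded i x -> insert i (x i) (drop_stream i.+1 x) = x.
Proof.
move=> px; apply/funext => n; rewrite insertE /drop_stream.
by case: ltngtP => [/px//|ni|->//]; rewrite subnKC.
Qed.

Lemma drop_pad i x : drop_stream i (pad i x) = x.
Proof.
by apply/funext => n; rewrite /drop_stream /pad ltnNge leq_addr/= addKn.
Qed.

Lemma pad_drop i x : padded i x -> pad i (drop_stream i x) = x.
Proof.
move=> px; apply/funext => n; rewrite /pad /drop_stream.
by case: ltnP => [/px//|ni]; rewrite subnKC.
Qed.

Lemma lead_insert i y x : y <> z -> lead (insert i y x) = Some i.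
Proof.
by move=> yz; apply: lead_padded; [exact: insert_padded|rewrite insert_at].
Qed.

Definition agree n x x' : Prop := forall k, (k < n)%N -> x k = x' k.

Lemma agreeP x x' : (forall n, agree n x x') -> x = x'.
Proof. by move=> h; apply/funext => n; exact: (h n.+1). Qed.

(** The inserted letter lengthens the common prefix, so each level of the recursions below settles
    at least one more term. *)
Lemma agree_insert n i y x x' :
  agree n x x' -> agree n.+1 (insert i y x) (insert i y x').
Proof.
move=> xx' k kn; rewrite !insertE; case: ltngtP => // ik.
by apply: xx'; rewrite ltn_subLR// addSn (leq_trans kn)// ltnS leq_addl.
Qed.

End Streams.

(** * The homeomorphism [phi_l] and its inverse *)

Section Absorb.
Variables (Y : topologicalType) (z p : Y) (P : nat -> set Y).
Hypotheses (P_clopen : forall n, clopen (P n))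
  (P_decr : forall m n, (m <= n)%N -> P n `<=` P m)
  (Pp : forall n, P n p)
  (P_base : forall U, nbhs p U -> exists n, P n `<=` U)
  (P_inter : forall a, (forall n, P n a) -> a = p)
  (Pz : ~ P 0 z) (z_clopen : clopen [set z]).

Local Notation T := (omega_power Y).
Implicit Types (x w : nat -> Y) (l n i d k : nat) (a y : Y).

Definition Q n : set Y := P n `\` P n.+1.

Lemma Q_clopen n : clopen (Q n).
Proof. exact: clopenD. Qed.

Lemma P_le m n y : (m <= n)%N -> P n y -> P m y.
Proof. by move=> mn; exact: P_decr. Qed.

Lemma P_neq n y : P n y -> y <> z.
Proof. by move=> /(P_decr (leq0n n)) Py yz; rewrite yz in Py. Qed.

Lemma Q_inj m n y : Q m y -> Q n y -> m = n.
Proof.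
move=> [Pm nPm] [Pn nPn]; case: (ltngtP m n) => // mn.
  by case: nPm; exact: P_le mn Pn.
by case: nPn; exact: P_le mn Pm.
Qed.

(* The displacement by one makes room for the pieces [Q (l + k)] that are moved
   to the front, as in Hilbert's hotel. *)
Definition shift_out l i y : nat := if pselect ((P l `\` P (l + i)) y) then i.-1 else i.
Definition shift_in l d y : nat :=
  if pselect ((P l `\` P (l + d).+1) y) then d.+1 else d.

(** If [y] is in [Q (l + k)], then [shift_out] maps the naturals other than [k] bijectively onto all
    naturals, lowering those above [k] by one, and [shift_in] is the inverse. If [y] is in no such
    ring, both are the identity. *)
Lemma shift_outK l i y : ~ Q (l + i) y -> shift_in l (shift_out l i y) y = i.
Proof.
move=> nQ; rewrite /shift_out; case: pselect => /= [[Pl nP]|h].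
  clear nQ; case: i nP => [|i] nP; first by rewrite addn0 in nP.
  by rewrite /shift_in -addnS; case: pselect => // -[].
rewrite /shift_in; case: pselect => // -[Pl nP]; case: h; split=> // Pli.
by apply: nQ.
Qed.

Lemma shift_inK l d y :
  shift_out l (shift_in l d y) y = d /\ ~ Q (l + shift_in l d y) y.
Proof.
rewrite /shift_in; case: pselect => /= [[Pl nP]|h]; last first.
  split=> [|[Pd nPd]].
    rewrite /shift_out; case: pselect => // -[Pl nP]; case: h; split=> //.
    by move=> Pd; apply: nP; exact: P_le (leqnSn _) Pd.
  by apply: h; split=> //; exact: P_le (leq_addr _ _) Pd.
rewrite -addnS in nP; split; last by case.
by rewrite /shift_out; case: pselect => // -[].
Qed.

Lemma shift_out_ge l i y : (i.-1 <= shift_out l i y <= i)%N.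
Proof. by rewrite /shift_out; case: pselect => /= _; rewrite leqnn leq_pred. Qed.

Lemma shift_in_ge l d y : (d <= shift_in l d y)%N.
Proof. by rewrite /shift_in; case: pselect => /=. Qed.

(** The map [phi_l] cut off after [n] unfoldings. The default is the image of the constant sequence
    [z]; its front [p] is also the correct one when the recursion never stops. *)
Fixpoint fwd_approx n l x : Y * (nat -> Y) :=
  if n is n'.+1 then
    if lead z x is Some i then
      let y := x i in let x' := drop_stream i.+1 x in
      if pselect (Q (l + i) y) then (y, pad z i x') else
      let d := shift_out l i y in
      let r := fwd_approx n' (l + d).+1 x' in (r.1, insert z d y r.2)
    else (p, fun=> z)
  else (p, fun=> z).

(** The test for [k] recognises the stopping case, whose image has its front in [Q (l + k)] and a
    tail beginning with [z^k]. The rings are disjoint, so the chosen [k] is the only one. *)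
Fixpoint bwd_approx n l (aw : Y * (nat -> Y)) : nat -> Y :=
  if n is n'.+1 then
    if pselect (exists k, Q (l + k) aw.1 /\ padded z k aw.2) is left h then
      insert z (projT1 (cid h)) aw.1 (drop_stream (projT1 (cid h)) aw.2) else
    if lead z aw.2 is Some d then
      let y := aw.2 d in
      insert z (shift_in l d y) y
        (bwd_approx n' (l + d).+1 (aw.1, drop_stream d.+1 aw.2))
    else fun=> z
  else fun=> z.

Lemma fwd_approx_agree n m l x :
  agree (minn n m) (fwd_approx n l x).2 (fwd_approx m l x).2.
Proof.
elim: n m l x => [|n IH] [|m] l x; rewrite ?min0n ?minn0// minnSS /=.
case: (lead z x) => [i|] //; case: pselect => //= _ /=.
exact: agree_insert.
Qed.

Lemma bwd_approx_agree n m l aw :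
  agree (minn n m) (bwd_approx n l aw) (bwd_approx m l aw).
Proof.
elim: n m l aw => [|n IH] [|m] l aw; rewrite ?min0n ?minn0// minnSS /=.
case: pselect => //= _; case: (lead z aw.2) => [d|] //.
exact: agree_insert.
Qed.

(** Here [p] acts as an undefined value: a front other than [p] can only come from a stop, and
    further unfoldings keep it. *)
Lemma fwd_approx_front n m l x : (n <= m)%N -> (fwd_approx n l x).1 <> p ->
  (fwd_approx m l x).1 = (fwd_approx n l x).1.
Proof.
elim: n m l x => [|n IH] [|m] l x //=; rewrite ltnS => nm.
by case: (lead z x) => [i|] //; case: pselect => //= _ /=; exact: IH.
Qed.

Definition fwd_front l x : Y :=
  if pselect (exists n, (fwd_approx n l x).1 <> p) is left h
  then (fwd_approx (projT1 (cid h)) l x).1 else p.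

(** Term [n] is read from approximation [n.+1]; by [fwd_approx_agree] it does not change
    afterwards. *)
Definition fwd l x : Y * (nat -> Y) :=
  (fwd_front l x, fun n => (fwd_approx n.+1 l x).2 n).

Definition bwd l aw : nat -> Y := fun n => bwd_approx n.+1 l aw n.

Lemma fwd_frontE l x a : (forall n, (fwd_approx n l x).1 = p \/ (fwd_approx n l x).1 = a) ->
  (exists n, (fwd_approx n l x).1 = a) -> fwd_front l x = a.
Proof.
move=> h [n na]; rewrite /fwd_front; case: pselect => /= [e|ne].
  by case: cid => m /= mp; case: (h m).
by apply: contrapT => pa; apply: ne; exists n; rewrite na => ap; apply: pa.
Qed.

Lemma fwd_frontP l x :
  (forall n, (fwd_approx n l x).1 = p \/ (fwd_approx n l x).1 = fwd_front l x) /\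
  exists n, (fwd_approx n l x).1 = fwd_front l x.
Proof.
rewrite /fwd_front; case: pselect => /= [e|ne].
  case: cid => m /= mp; split; last by exists m.
  move=> n; case: (eqVneq (fwd_approx n l x).1 p) => [|/eqP np]; first by left.
  by right; case: (leqP n m) => [nm|/ltnW mn]; [rewrite (fwd_approx_front nm)
    |rewrite (fwd_approx_front mn)].
by split; [move=> n; left; apply: contrapT => np; apply: ne; exists n|exists 0%N].
Qed.

Lemma fwd_cst l : fwd l (fun=> z) = (p, fun=> z).
Proof.
rewrite /fwd; congr pair; last by apply/funext => n /=; rewrite lead_cst.
apply: fwd_frontE; last by exists 0%N.
by case=> [|n] /=; [left|rewrite lead_cst; left].
Qed.

Lemma fwd_stop l i x : lead z x = Some i -> Q (l + i) (x i) ->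
  fwd l x = (x i, pad z i (drop_stream i.+1 x)).
Proof.
move=> lx Qx; rewrite /fwd; congr pair; last first.
  by apply/funext => n /=; rewrite lx; case: pselect.
apply: fwd_frontE; last by exists 1%N; rewrite /= lx; case: pselect.
by case=> [|n] /=; [left|rewrite lx; case: pselect => //; right].
Qed.

Lemma fwd_step l i x : lead z x = Some i -> ~ Q (l + i) (x i) ->
  let d := shift_out l i (x i) in
  let r := fwd (l + d).+1 (drop_stream i.+1 x) in
  fwd l x = (r.1, insert z d (x i) r.2).
Proof.
move=> lx Qx d r; rewrite [fwd l x]/fwd; congr pair; last first.
  apply/funext => n; rewrite [LHS]/= lx; case: pselect => //= _.
  rewrite !insertE -/d; case: ltngtP => // dn.
  (* Both sides read the tail at [n - d.+1], one after [n] unfoldings and the other after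
     [(n - d.+1).+1]. Both numbers exceed the index. *)
  apply: (@fwd_approx_agree n (n - d.+1).+1 _ _ (n - d.+1)%N).
by rewrite leq_min leqnn andbT ltn_subLR // addSn ltnS leq_addl.
have [h [m hm]] := fwd_frontP (l + d).+1 (drop_stream i.+1 x).
apply: fwd_frontE => [[|n]|]; first by left.
  by rewrite /= lx; case: pselect => //= _; exact: h.
by exists m.+1; rewrite /= lx; case: pselect.
Qed.

Lemma bwd_stop l k a w : Q (l + k) a -> padded z k w ->
  bwd l (a, w) = insert z k a (drop_stream k w).
Proof.
move=> Qa pw; apply/funext => n; rewrite /bwd /=; case: pselect => /= [h|[]]; last by exists k.
case: cid => k' /= [Qa' _]; have /eqP := Q_inj Qa' Qa.
by rewrite eqn_add2l => /eqP ->.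
Qed.

Lemma bwd_cst l a : (forall k, ~ Q (l + k) a) -> bwd l (a, fun=> z) = fun=> z.
Proof.
move=> nQ; apply/funext => n; rewrite /bwd /=; case: pselect => /= [h|_];
  last by rewrite lead_cst.
by exfalso; case: h => k [/nQ].
Qed.

(** The stopping case is excluded: a stopping index [k] would satisfy [k <= d] because [w d <> z],
    but [a] lies too deep to be in such a ring [Q (l + k)]. *)
Lemma bwd_step l d a w : lead z w = Some d -> P (l + d).+1 a ->
  bwd l (a, w) = insert z (shift_in l d (w d)) (w d)
    (bwd (l + d).+1 (a, drop_stream d.+1 w)).
Proof.
move=> lw Pa; apply/funext => n; rewrite /bwd /=; case: pselect => /= [h|_].
  exfalso; case: (h) => k [[_ nP] pw]; have [pd wd] := leadS lw.
  have [dk|kd] := ltnP d k; first by apply: wd; exact: pw.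
  by apply: nP; apply: P_le Pa; rewrite ltnS leq_add2l.
rewrite lw !insertE; set i := shift_in l d (w d); case: ltngtP => // dn.
apply: (@bwd_approx_agree n (n - i.+1).+1 _ _ (n - i.+1)%N).
by rewrite leq_min leqnn andbT ltn_subLR // addSn ltnS leq_addl.
Qed.

Lemma P_fwd l x : P l (fwd l x).1.
Proof.
rewrite /=; have [_ [n <-]] := fwd_frontP l x.
elim: n l x => [|n IH] l x //=; case: (lead z x) => [i|] //.
case: pselect => [[Pi _]|_] /=; first by apply: P_le Pi; rewrite leq_addr.
by apply: P_le (IH _ _); rewrite -addnS leq_addr.
Qed.

Lemma not_stopped l m a : P l a -> (forall k, (k < m)%N -> ~ Q (l + k) a) -> P (l + m) a.
Proof.
move=> Pl; elim: m => [|m IH] nQ; first by rewrite addn0.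
rewrite addnS; apply: contrapT => nP; apply: (nQ m) => //; split=> //.
by apply: IH => k km; apply: nQ; exact: ltnW.
Qed.

(** Induction on the length of the common prefix: every unfolding restores at least one term, so a
    recursion that never stops needs no separate limit argument. *)
Lemma fwdK l x : bwd l (fwd l x) = x.
Proof.
apply: agreeP => n; elim: n l x => [//|n IH] l x.
case lx : (lead z x) => [i|]; last first.
  move/leadN: lx => ->; rewrite fwd_cst bwd_cst // => k [_]; exact.
have [px xi] := leadS lx.
have [Qx|nQx] := pselect (Q (l + i) (x i)).
  rewrite (fwd_stop lx Qx) (bwd_stop Qx); last exact: pad_padded.
  by rewrite drop_pad insert_drop.
rewrite (fwd_step lx nQx); set d := shift_out _ _ _.
rewrite (@bwd_step _ d); last exact: P_fwd; last exact: lead_insert.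
rewrite insert_at drop_insert shift_outK// -surjective_pairing.
rewrite -[X in agree _ _ X](insert_drop px); exact: agree_insert.
Qed.

Lemma not_stopped_lead l d a w : P l a ->
  ~ (exists k, Q (l + k) a /\ padded z k w) -> lead z w = Some d -> P (l + d).+1 a.
Proof.
move=> Pa nk /leadS[pw _]; rewrite -addnS; apply: not_stopped => // k kd Qa.
by apply: nk; exists k; split=> // j jk; apply: pw; exact: leq_trans jk kd.
Qed.

Lemma bwdK l a w : P l a -> fwd l (bwd l (a, w)) = (a, w).
Proof.
move=> Pa.
(* The fronts need a second clause, as no finite number of unfoldings may reveal them. If they are
   never identified, both lie in every [P n] and so equal [p]. *)
suff H n : agree n (fwd l (bwd l (a, w))).2 w /\
    ((fwd l (bwd l (a, w))).1 = a \/ P (l + n) (fwd l (bwd l (a, w))).1 /\ P (l + n) a).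
  rewrite [LHS]surjective_pairing; congr pair; last first.
    by apply: agreeP => n; have [] := H n.
  apply: contrapT => neq; have {}H n : P n (fwd l (bwd l (a, w))).1 /\ P n a.
    have [_ [//|[]]] := H n => P1 P2.
    by split; [apply: P_le P1|apply: P_le P2]; exact: leq_addl.
  by apply: neq; rewrite (P_inter (fun n => (H n).1)) (P_inter (fun n => (H n).2)).
elim: n l a w Pa => [|n IH] l a w Pa.
  by split=> //; right; rewrite addn0; split=> //; exact: P_fwd.
have [[k [Qa pw]]|nk] := pselect (exists k, Q (l + k) a /\ padded z k w).
  rewrite (bwd_stop Qa pw).
  have lk : lead z (insert z k a (drop_stream k w)) = Some k.
    by apply: lead_insert; exact: P_neq Qa.1.
  rewrite (fwd_stop lk) insert_at//= drop_insert pad_drop//.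
  by split=> //; left.
case lw : (lead z w) => [d|]; last first.
  (* The constant [w] is padded for every [k], so [a] is in no ring [Q (l + k)]; this forces
     [a = p]. *)
  have nQ k : ~ Q (l + k) a.
    by move=> Qa; apply: nk; exists k; split=> //; move/leadN: lw => ->.
  move/leadN: lw => ->; rewrite (bwd_cst nQ) fwd_cst; split=> //=; left.
  apply/esym/P_inter => m; apply: (@P_le m (l + m)); first exact: leq_addl.
  by apply: not_stopped.
have [pw wd] := leadS lw.
have Pd := not_stopped_lead Pa nk lw.
rewrite (bwd_step lw Pd); set i := shift_in _ _ _; set v := bwd _ _.
have li : lead z (insert z i (w d) v) = Some i by exact: lead_insert.
have [io nQ] := shift_inK l d (w d).
rewrite (fwd_step li) ?insert_at// drop_insert io.
have [ag fr] := IH _ _ (drop_stream d.+1 w) Pd; split.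
  by rewrite -[X in agree _ _ X](insert_drop pw); exact: agree_insert.
case: fr => [|[P1 P2]]; [by left|right].
by rewrite -addSnnS; split; [apply: P_le P1|apply: P_le P2];
  rewrite leq_add2r ltnS leq_addr.
Qed.

Lemma shift_out_near l i y : \forall y' \near y, shift_out l i y' = shift_out l i y.
Proof.
have := @clopen_near _ (P l `\` P (l + i)) y (clopenD (P_clopen _) (P_clopen _)).
by apply: filterS => y' [h h']; rewrite /shift_out;
  case: pselect => /= [/h|/(contra_not h')]; case: pselect.
Qed.

Lemma shift_in_near l d y : \forall y' \near y, shift_in l d y' = shift_in l d y.
Proof.
have := @clopen_near _ (P l `\` P (l + d).+1) y (clopenD (P_clopen _) (P_clopen _)).
by apply: filterS => y' [h h']; rewrite /shift_in;
  case: pselect => /= [/h|/(contra_not h')]; case: pselect.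
Qed.

Lemma padded_near i (x : T) : padded z i x -> \forall x' \near x, padded z i x'.
Proof.
move=> px; apply: (@nbhs_box Y i (fun=> [set z])) => j ji.
by apply: open_nbhs_nbhs; split; [exact: z_clopen.1|exact: px].
Qed.

(** Since [z] is isolated and closed, both the leading block and the fact that the next letter
    differs from [z] persist nearby. Only at the constant sequence can [lead] fail to be locally
    constant. *)
Lemma lead_near i (x : T) : lead z x = Some i -> \forall x' \near x, lead z x' = Some i.
Proof.
move=> /leadS[px xi]; apply: filterS2 (padded_near px) _; last first.
  exact: near_preimage (@coord_continuous Y i x) (clopen_near (x i) z_clopen).
by move=> x' /= px' [h _]; apply: lead_padded => // /h.
Qed.

Lemma drop_continuous i : continuous (drop_stream i : T -> T).
Proof. by move=> x; apply: omega_continuous => n; exact: coord_continuous. Qed.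

Lemma insert_continuous (S : topologicalType) i (f : S -> Y) (g : S -> nat -> Y) n (s : S) :
  {for s, continuous f} ->
  ((i < n)%N -> {for s, continuous (fun t => g t (n - i.+1)%N)}) ->
  {for s, continuous (fun t => insert z i (f t) (g t) n)}.
Proof.
move=> cf cg; apply: (@continuous_near_eq _ _ _
    (fun t => if (n < i)%N then z else if n == i then f t else g t (n - i.+1)%N)).
  by apply: nearW => t; exact: insertE.
by case: ltngtP => [_|/cg//|//]; exact: cst_continuous.
Qed.

(** Controls [fwd] near the constant sequence. Term [n] requires a block of length [n.+1] in the
    output, and [shift_out] may shorten the block by one, hence [n.+2]. *)
Lemma fwd_padded n l x : padded z n.+2 x -> (fwd l x).2 n = z.
Proof.
move=> px; case lx : (lead z x) => [i|]; last first.
  by rewrite (leadN lx) fwd_cst.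
have [_ xi] := leadS lx.
have ni : (n.+1 < i)%N by rewrite ltnNge; apply/negP => /px.
have [Qx|nQx] := pselect (Q (l + i) (x i)).
  by rewrite (fwd_stop lx Qx)/= /pad (ltnW ni).
rewrite (fwd_step lx nQx) [LHS]insert_padded//.
have /andP[+ _] := shift_out_ge l i (x i); apply: leq_trans.
by rewrite -ltnS prednK// (leq_trans _ ni).
Qed.

(** The depth of [a] forces any stopping index above [n], and [shift_in] never shortens the block,
    so [n.+1] letters suffice. *)
Lemma bwd_padded n l a w : P (l + n.+1) a -> padded z n.+1 w -> bwd l (a, w) n = z.
Proof.
move=> Pa pw; have [[k [[Pk nPk] pk]]|nk] :=
    pselect (exists k, Q (l + k) a /\ padded z k w).
  rewrite (bwd_stop (conj Pk nPk) pk) [LHS]insert_padded//.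
  rewrite -ltnS ltnNge; apply/negP => kn; apply: nPk; apply: P_le Pa.
  by rewrite -addnS leq_add2l.
case lw : (lead z w) => [d|]; last first.
  rewrite (leadN lw) bwd_cst// => k Qk; apply: nk; exists k; split=> //.
  by rewrite (leadN lw).
have [pd wd] := leadS lw.
have nd : (n < d)%N by rewrite ltnNge; apply/negP => /pw.
rewrite (bwd_step lw).
  by rewrite [LHS]insert_padded//; apply: leq_trans nd _; exact: shift_in_ge.
by apply: not_stopped_lead nk lw; exact: P_le (leq_addr _ _) Pa.
Qed.

Lemma fwd_stop_near l i (x : T) : lead z x = Some i -> Q (l + i) (x i) ->
  \forall x' \near x, fwd l x' = (x' i, pad z i (drop_stream i.+1 x')).
Proof.
move=> lx Qx; have nQ := near_preimage (@coord_continuous Y i x)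
  (clopen_near (x i) (Q_clopen (l + i))).
apply: filterS2 (lead_near lx) nQ => x' lx' [_ h].
by apply: fwd_stop => //; exact: h.
Qed.

Lemma fwd_step_near l i (x : T) : lead z x = Some i -> ~ Q (l + i) (x i) ->
  let d := shift_out l i (x i) in
  \forall x' \near x, let r := fwd (l + d).+1 (drop_stream i.+1 x') in
    fwd l x' = (r.1, insert z d (x' i) r.2).
Proof.
move=> lx Qx d; have nQ := near_preimage (@coord_continuous Y i x)
  (clopen_near (x i) (Q_clopen (l + i))).
have nd := near_preimage (@coord_continuous Y i x) (shift_out_near l i (x i)).
apply: filterS3 (lead_near lx) nQ nd => x' lx' [h _] /= hd.
by rewrite (fwd_step lx') ?hd// => /h.
Qed.

(** Near a non-constant [x] the choice of case and the indices are locally constant, and term [n] is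
    then [z], a coordinate of the argument, or an earlier term of the recursive call. At the
    constant sequence [fwd_padded] applies. *)
Lemma fwd_coord_continuous n l (x : T) :
  {for x, continuous (fun x' : T => (fwd l x').2 n)}.
Proof.
elim/ltn_ind: n l x => n IH l x; case lx : (lead z x) => [i|]; last first.
  apply: (@continuous_near_eq _ _ _ (fun=> z)); last exact: cst_continuous.
  have : padded z n.+2 x by rewrite (leadN lx).
  by move=> /padded_near; apply: filterS => x' /fwd_padded ->.
have [Qx|nQx] := pselect (Q (l + i) (x i)).
  apply: (@continuous_near_eq _ _ _ (fun x' : T => pad z i (drop_stream i.+1 x') n)).
    by apply: filterS (fwd_stop_near lx Qx) => x' ->.
  by rewrite /pad; case: ltnP => _; [exact: cst_continuous|exact: coord_continuous].
set d := shift_out l i (x i).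
apply: (@continuous_near_eq _ _ _ (fun x' : T =>
    insert z d (x' i) (fwd (l + d).+1 (drop_stream i.+1 x')).2 n)).
  by apply: filterS (fwd_step_near lx nQx) => x' ->.
apply: insert_continuous; first exact: coord_continuous.
move=> dn; apply: (@continuous_compose T T Y (drop_stream i.+1)
    (fun x' : T => (fwd (l + d).+1 x').2 (n - d.+1)%N)).
  exact: drop_continuous.
by apply: IH; rewrite ltn_subrL (leq_ltn_trans _ dn).
Qed.

Lemma fwd_front_padded m l x : padded z m.+1 x -> P (l + m) (fwd l x).1.
Proof.
move=> px; case lx : (lead z x) => [i|]; last by rewrite (leadN lx) fwd_cst.
have [_ xi] := leadS lx.
have mi : (m < i)%N by rewrite ltnNge; apply/negP => /px.
have [Qx|nQx] := pselect (Q (l + i) (x i)).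
  by rewrite (fwd_stop lx Qx); apply: P_le Qx.1; rewrite leq_add2l ltnW.
rewrite (fwd_step lx nQx); apply: P_le (P_fwd _ _).
have /andP[+ _] := shift_out_ge l i (x i).
rewrite -addnS leq_add2l => h; apply: leq_trans (leqW h).
by rewrite -ltnS prednK// (leq_trans _ mi).
Qed.

(** The number [n] bounds the unfoldings to be followed, since each raises the level by at least
    one. Either the front is outside [P (l + n)] and the recursion has stopped by then, or every
    later front falls into [V] anyway. *)
Lemma fwd_front_near n l (x : T) V : nbhs (fwd l x).1 V ->
  ~ P (l + n) (fwd l x).1 \/ P (l + n) `<=` V ->
  \forall x' \near x, V (fwd l x').1.
Proof.
elim: n l x => [|n IH] l x nV.
  rewrite addn0 => -[/(_ (P_fwd _ _))//|PV].
  by apply: filterS filterT => x' _; apply: PV; exact: P_fwd.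
case lx : (lead z x) => [i|]; last first.
  rewrite (leadN lx) fwd_cst /= => -[/(_ (Pp _))//|PV].
  have : padded z n.+2 x by rewrite (leadN lx).
  by rewrite -(leadN lx) => /padded_near; apply: filterS => x' /fwd_front_padded /PV.
have [Qx|nQx] := pselect (Q (l + i) (x i)).
  move=> _; rewrite (fwd_stop lx Qx)/= in nV.
  apply: filterS2 (fwd_stop_near lx Qx) (near_preimage (@coord_continuous Y i x) nV).
  by move=> x' ->.
have := fwd_step_near lx nQx; set d := shift_out l i (x i) => ns.
rewrite (nbhs_singleton ns)/= in nV * => hV.
have sub : P ((l + d).+1 + n) `<=` P (l + n.+1).
  by apply: P_decr; rewrite -addSnnS leq_add2r ltnS leq_addr.
have {}hV : ~ P ((l + d).+1 + n) (fwd (l + d).+1 (drop_stream i.+1 x)).1 \/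
    P ((l + d).+1 + n) `<=` V.
  case: hV => [nP|PV]; [left|right]; first by move=> /sub.
  exact: subset_trans PV.
have := near_preimage (@drop_continuous i.+1 x) (IH _ _ nV hV).
by apply: filterS2 ns => x' e Vx'; change (V (fwd l x').1); rewrite e.
Qed.

Lemma fwd_continuous l : continuous (fwd l : T -> Y * T).
Proof.
move=> x; apply: continuous_pair; last first.
  by apply: omega_continuous => n; exact: fwd_coord_continuous.
move=> V nV; have [ap|ap] := pselect ((fwd l x).1 = p).
  have [n PV] : exists n, P n `<=` V by apply: P_base; rewrite -ap.
  apply: (@fwd_front_near n) => //; right; apply: subset_trans PV.
  by apply: P_decr; exact: leq_addl.
have [n nP] : exists n, ~ P n (fwd l x).1.
  by apply/existsNP => h; apply: ap; exact: P_inter.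
apply: (@fwd_front_near n) => //; left; apply: contra_not nP.
by apply: P_le; exact: leq_addl.
Qed.

(** The case and the indices are locally constant unless [w] is constantly [z] and [a] is in no ring
    [Q (l + k)]; there [bwd_padded] makes term [n] equal to [z] nearby. *)
Lemma bwd_coord_continuous n l (aw : Y * T) : P l aw.1 ->
  {for aw, continuous (fun aw' : Y * T => bwd l aw' n)}.
Proof.
elim/ltn_ind: n l aw => n IH l [a w] /= Pa.
have c1 : {for (a, w), continuous (fst : Y * T -> Y)} by exact: cvg_fst.
have c2 : {for (a, w), continuous (snd : Y * T -> T)} by exact: cvg_snd.
have near1 (A : set Y) : clopen A -> A a -> \forall aw \near (a, w), A aw.1.
  by move=> [oA _] Aa; apply: (near_preimage c1); exact: open_nbhs_nbhs.
have [[k [Qa pw]]|nk] := pselect (exists k, Q (l + k) a /\ padded z k w).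
  apply: (@continuous_near_eq _ _ _ (fun aw : Y * T =>
      insert z k aw.1 (drop_stream k aw.2) n)).
    apply: filterS2 (near1 _ (Q_clopen _) Qa) (near_preimage c2 (padded_near pw)).
    by move=> [a' w'] /= Qa' pw'; rewrite (bwd_stop Qa' pw').
  apply: insert_continuous => // _.
  by apply: (continuous_compose c2 (g := fun w : T => w _)); exact: coord_continuous.
case lw : (lead z w) => [d|]; last first.
  have Pn : P (l + n.+1) a.
    apply: not_stopped => // k _ Qk; apply: nk; exists k; split=> //.
    by rewrite (leadN lw).
  apply: (@continuous_near_eq _ _ _ (fun=> z)); last exact: cst_continuous.
  have pw : padded z n.+1 w by rewrite (leadN lw).
  apply: filterS2 (near1 _ (P_clopen _) Pn) (near_preimage c2 (padded_near pw)).
  by move=> [a' w'] /= Pa' pw'; rewrite bwd_padded.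
have Pd := not_stopped_lead Pa nk lw.
have cd : {for (a, w), continuous (fun aw : Y * T => aw.2 d)}.
  by apply: (continuous_compose c2 (g := fun w : T => w _)); exact: coord_continuous.
set i := shift_in l d (w d).
apply: (@continuous_near_eq _ _ _ (fun aw : Y * T =>
    insert z i (aw.2 d) (bwd (l + d).+1 (aw.1, drop_stream d.+1 aw.2)) n)).
  apply: filterS3 (near1 _ (P_clopen _) Pd) (near_preimage c2 (lead_near lw))
    (near_preimage cd (shift_in_near l d (w d))).
  by move=> [a' w'] /= Pa' lw' si; rewrite (bwd_step lw' Pa') si.
apply: insert_continuous => // ni.
apply: (@continuous_compose _ (Y * T)%type _
    (fun aw : Y * T => (aw.1, drop_stream d.+1 aw.2 : T))
    (fun aw : Y * T => bwd (l + d).+1 aw (n - i.+1)%N)).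
  apply: continuous_pair => //.
  by apply: (continuous_compose c2 (g := (drop_stream d.+1 : T -> T))); exact: drop_continuous.
by apply: IH => //; rewrite ltn_subrL (leq_ltn_trans _ ni).
Qed.

Lemma absorb_level l : set_homeo (P l `*` [set: T]) [set: T].
Proof.
exists (bwd l : Y * T -> T), (fwd l); split=> [[a w] [/= Pa _]|x _].
  split=> //; first exact: bwdK.
  by apply: omega_continuous => n; exact: bwd_coord_continuous.
split; [by split=> //; exact: P_fwd|exact: fwdK|exact: fwd_continuous].
Qed.

End Absorb.

(** * Decreasing clopen bases at a point *)

Definition clopen_base_at (T : topologicalType) (p : T) : Prop :=
  exists P : nat -> set T, [/\ forall n, clopen (P n),
    forall m n, (m <= n)%N -> P n `<=` P m, forall n, P n p &
    forall U, nbhs p U -> exists n, P n `<=` U].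

Lemma factor_absorb (Y : topologicalType) (z p : Y) (U : set Y) :
  accessible_space Y -> open [set z] -> clopen U -> ~ U z -> U p ->
  clopen_base_at p ->
  set_homeo (U `*` [set: omega_power Y]) [set: omega_power Y].
Proof.
move=> T1 oz cU Uz Up [P [cP dP Pp bP]].
(* The chain has to begin with [U] itself, so the given base is shifted by one and cut down to
   [U]. *)
pose P' n := U `&` (if n is m.+1 then P m else setT).
have -> : U = P' 0%N by rewrite /P' setIT.
have T1c := accessible_closed_set1 T1.
apply: (absorb_level (p := p) (z := z)) => //.
- by move=> [|n]; apply: clopenI => //; exact: clopenT.
- move=> m n mn y [Uy Py]; split=> //.
  by case: m n mn Py => [|m] [|n] //= mn; exact: dP.
- by move=> [|n]; split=> //; exact: Pp.
- by move=> V /bP[n PV]; exists n.+1 => y [_ /PV].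
- move=> a Pa; apply: contrapT => ap.
  have : nbhs p (~` [set a]).
    apply: open_nbhs_nbhs; split; last by move=> pa; apply: ap.
    exact: closed_openC.
  by move=> /bP[n sub]; have [_ /sub] := Pa n.+1; apply.
- by move=> [].
Qed.

Lemma zero_dimensional_nbhs (X : topologicalType) (x : X) (U : set X) :
  zero_dimensional_space X -> nbhs x U ->
  exists V, [/\ clopen V, V x & V `<=` U].
Proof.
move=> [B [oB Bcvg] cB] /(Bcvg x)[V [BV Vx] VU].
by exists V; split=> //; exact: cB.
Qed.

Lemma clopen_base_at_first_countable (X : topologicalType) (x : X) :
  zero_dimensional_space X -> first_countable_space X -> clopen_base_at x.
Proof.
move=> zX /(_ x)[B [/pcard_leP[f] Bx Bbase]].
pose E n := [set V | B V /\ f V = n].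
have EP n : exists V, [/\ clopen V, V x & forall W, E n W -> V `<=` W].
  have [[W [BW fW]]|nE] := pselect (E n !=set0).
    have [V [cV Vx VW]] := zero_dimensional_nbhs zX (Bx _ BW).
    exists V; split=> // W' [BW' fW']; rewrite (_ : W' = W)//.
    apply: (@inj _ _ B f W' W); rewrite ?in_setE//.
    exact: etrans fW' (esym fW).
  exists setT; split=> //; first exact: clopenT.
  by move=> W EW; case: nE; exists W.
pose V n := projT1 (cid (EP n)).
have VP n : [/\ clopen (V n), V n x & forall W, E n W -> V n `<=` W].
  by rewrite /V; case: cid.
exists (fun n => [set y | forall j, (j <= n)%N -> V j y]); split.
- elim=> [|n [IHo IHc]].
    rewrite (_ : [set y | _] = V 0%N); first by have [] := VP 0%N.
    by apply/seteqP; split=> y /=; [exact|move=> Vy j; rewrite leqn0 => /eqP->].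
  rewrite (_ : [set y | _] = [set y | forall j, (j <= n)%N -> V j y] `&` V n.+1).
    by apply: clopenI => //; have [] := VP n.+1.
  apply/seteqP; split=> y /= => [Vy|[Vy Vn] j].
    by split=> [j jn|]; apply: Vy => //; exact: leqW.
  by rewrite leq_eqVlt => /orP[/eqP->//|]; exact: Vy.
- by move=> m n mn y /= Vy j jm; apply: Vy; exact: leq_trans mn.
- by move=> n j _; have [] := VP j.
- move=> U /Bbase[W BW WU]; exists (f W) => y /= /(_ _ (leqnn _)) Vy; apply: WU.
  by have [_ _] := VP (f W); apply.
Qed.

(** Continuity of the left inverse [r] at [e p] makes the pulled back sets small around [p]. This
    serves for adjoined points, for clopen subspaces, and for constant sequences in a power. *)
Lemma clopen_base_at_transfer (S T : topologicalType) (e : T -> S) (r : S -> T)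
    (W : set T) (p : T) :
  clopen W -> W p -> continuous e -> {for e p, continuous r} ->
  (forall x, W x -> r (e x) = x) -> clopen_base_at (e p) -> clopen_base_at p.
Proof.
move=> cW Wp ce cr re [P [cP dP Pp bP]].
exists (fun n => W `&` e @^-1` P n); split.
- by move=> n; apply: clopenI => //; exact: preimage_clopen.
- by move=> m n mn x [Wx Px]; split=> //; exact: dP mn _ Px.
- by move=> n; split=> //; exact: Pp.
- move=> U nU; have /bP[n PU] : nbhs (e p) (r @^-1` U) by apply: cr; rewrite re.
  by exists n => x [Wx /PU]; rewrite /= re.
Qed.

Lemma clopen_base_at_omega (X : topologicalType) (x : omega_power X) :
  (forall n, clopen_base_at (x n)) -> clopen_base_at x.
Proof.
move=> bx; pose P n := projT1 (cid (bx n)).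
have PP j : [/\ forall n, clopen (P j n),
    forall m n, (m <= n)%N -> P j n `<=` P j m, forall n, P j n (x j) &
    forall U, nbhs (x j) U -> exists n, P j n `<=` U].
  by rewrite /P; case: cid.
exists (fun n => box n (P^~ n)); split.
- by move=> n; apply: box_clopen => j; have [] := PP j.
- move=> m n mn y By j jm; have [_ dP _ _] := PP j.
  by apply: (dP _ _ mn); apply: By; exact: leq_trans mn.
- by move=> n j _; have [] := PP j.
- move=> U /nbhs_boxP[m [V [nV VU]]].
  have /choice[k kP] j : exists k, P j k `<=` V j.
    by have [_ _ _] := PP j; apply.
  (* A single index serves both as the length of the box and as the fineness in each of the first
     [m] coordinates. *)
  exists (maxn m (\max_(j < m) k j)) => y By; apply: VU => j jm.
  apply: kP; have [_ dP _ _] := PP j.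
  apply: (dP _ (maxn m (\max_(j < m) k j))); last by apply: By; rewrite leq_max jm.
  by rewrite leq_max (leq_bigmax (Ordinal jm)) orbT.
Qed.

(** * Shifting pieces that converge to the constant sequence *)

(** Where the two maps agree, it does not matter how [C] splits the neighbourhood. This handles the
    constant sequence, which the shifts below leave fixed. *)
Lemma continuous_glue (S T : topologicalType) (C : set S) (f f' : S -> T) (x : S) :
  f x = f' x -> {for x, continuous f} -> {for x, continuous f'} ->
  {for x, continuous (glue C f f')}.
Proof.
move=> ff' cf cf' V; have -> : glue C f f' x = f x by rewrite /glue; case: pselect.
move=> nV; have nV' : nbhs (f' x) V by rewrite -ff'.
apply: filterS2 (near_preimage cf nV) (near_preimage cf' nV') => y /=.
by rewrite /glue; case: pselect.
Qed.

Lemma cons_continuous (Y : topologicalType) (S : topologicalType) (s : S)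
    (f : S -> Y) (g : S -> omega_power Y) :
  {for s, continuous f} -> {for s, continuous g} ->
  {for s, continuous (fun t => cons_stream (f t) (g t) : omega_power Y)}.
Proof.
move=> cf cg; apply: omega_continuous => -[|n] //.
exact: (continuous_compose cg (@coord_continuous Y n (g s))).
Qed.

Lemma cons_stream_drop (Y : topologicalType) (x : nat -> Y) :
  cons_stream (x 0%N) (drop_stream 1 x) = x.
Proof. by apply/funext => -[|n]. Qed.

Lemma set_homeo_cons (Y : topologicalType) (U : set Y) (B : set (omega_power Y)) :
  set_homeo (U `*` B) [set x : omega_power Y | U (x 0%N) /\ B (drop_stream 1 x)].
Proof.
exists (fun ux => cons_stream ux.1 ux.2), (fun x => (x 0%N, drop_stream 1 x)).
split=> [[u x] [/= Uu Bx]|x [Ux Bx]].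
  by split=> //; apply: cons_continuous; [exact: cvg_fst|exact: cvg_snd].
split=> //; first exact: cons_stream_drop.
by apply: continuous_pair; [exact: coord_continuous|exact: drop_continuous].
Qed.

Lemma set_homeo_unit (Y S : topologicalType) (z : Y) :
  set_homeo ([set z] `*` [set: S]) [set: S].
Proof.
exists snd, (fun s => (z, s)); split=> [[y s] [/= -> _]|s _].
  by split=> //; exact: cvg_snd.
split=> //; apply: continuous_pair; first exact: cst_continuous.
exact: cvg_id.
Qed.

Section Swindle.
Variables (Y : topologicalType) (z : Y) (C : set (omega_power Y)).
Hypotheses (z_clopen : clopen [set z]) (C_clopen : clopen C).

Local Notation T := (omega_power Y).

Let D : set T := [set x | exists2 i, lead z x = Some i & ~ C (drop_stream i x)].

Let D_consE (x : T) : x 0%N = z -> D x <-> D (drop_stream 1 x).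
Proof.
move=> x0; have leadE i : lead z x = Some i.+1 <-> lead z (drop_stream 1 x) = Some i.
  split=> /leadS[px xi]; apply: lead_padded => //.
    by move=> j ji; exact: px.
  by case=> // j; exact: px.
split=> [[[|i]]|[i /leadE xi nC]]; last by exists i.+1.
  by move=> /leadS[].
by move=> /leadE xi nC; exists i.
Qed.

(** With [not_D], this shows that the domain of the swindle omits exactly the members of [D] not
    starting with [z], so on the rest of [D] a letter [z] can be removed. *)
Let D_head (x : T) : D x -> x 0%N = z \/ C x -> x 0%N = z.
Proof.
move=> [[|i] lx nC] [//|Cx]; first by case: nC.
by have [+ _] := leadS lx; apply.
Qed.

Let not_D (x : T) : ~ D x -> x 0%N = z \/ C x.
Proof.
move=> nD; have [|x0] := pselect (x 0%N = z); [by left|right].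
apply: contrapT => nC; apply: nD; exists 0%N; last exact: nC.
by apply: lead_padded.
Qed.

(** Away from the constant sequence [lead] is locally constant and [C] is clopen, so membership in
    [D] is locally constant too; at the constant sequence [f] and [f'] agree. *)
Let continuous_D (f f' : T -> T) (x : T) :
  continuous f -> continuous f' -> f (fun=> z) = f' (fun=> z) ->
  {for x, continuous (glue D f f')}.
Proof.
move=> cf cf' ff'; case lx : (lead z x) => [i|]; last first.
  by rewrite (leadN lx); exact: (continuous_glue ff' (cf _) (cf' _)).
have nC := near_preimage (@drop_continuous Y i x) (clopen_near (drop_stream i x : T) C_clopen).
have {nC} nD : \forall y \near x, D y <-> D x.
  apply: filterS2 (lead_near z_clopen lx) nC => y ly nC; split=> -[j].
    by rewrite ly => -[<-] h; exists i => // /nC.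
  by rewrite lx => -[<-] h; exists i => // /nC.
have [Dx|nDx] := pselect (D x).
  apply: continuous_near_eq (cf x).
  by apply: filterS nD => y [_ /(_ Dx) Dy]; rewrite /glue; case: pselect.
apply: continuous_near_eq (cf' x).
by apply: filterS nD => y [h _]; rewrite /glue; case: pselect => //= /h.
Qed.

(* Each piece [z^i c] with [c] outside [C] and not starting with [z] is moved
   to [z^(i+1) c], the others are left in place. *)
Lemma swindle : set_homeo ([set x : T | x 0%N = z] `|` C) [set: T].
Proof.
have ccons : continuous (cons_stream z : T -> T).
  by move=> x; apply: cons_continuous; [exact: cst_continuous|exact: cvg_id].
have cdrop : continuous (drop_stream 1 : T -> T) by exact: drop_continuous.
have cid : continuous (id : T -> T) by move=> x; exact: cvg_id.
have zE : cons_stream z (fun=> z) = fun=> z by apply/funext => -[].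
exists (glue D (drop_stream 1) id), (glue D (cons_stream z) id).
split=> x Ax; split=> //; try exact: continuous_D.
- rewrite {2}/glue; case: pselect => /= [Dx|nDx]; last by rewrite /glue; case: pselect.
  have x0 := D_head Dx Ax; have /(D_consE x0) Dx' := Dx.
  by rewrite /glue; case: pselect => //= _; rewrite -x0 cons_stream_drop.
- rewrite /glue; case: pselect => /= [Dx|nDx]; [by left|exact: not_D].
- rewrite {2}/glue; case: pselect => /= [Dx|nDx]; last by rewrite /glue; case: pselect.
  rewrite /glue; case: pselect => //= nD; case: nD.
  exact/(@D_consE (cons_stream z x) erefl).
Qed.

End Swindle.

(** * Clopen subsets of a power with an isolated letter *)

Section HHomogeneous.
Variables (Y : topologicalType) (z : Y).
Hypothesis z_clopen : clopen [set z].

Local Notation T := (omega_power Y).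

(** Since [U] is absorbed, the whole power is a copy of the sequences starting in [U], so [D] has a
    clopen copy [C] there. As [A] is a copy of the sequences starting with [z], [swindle] applies to
    the union. *)
Lemma absorb_clopen (U : set Y) (A D : set T) :
  clopen U -> ~ U z -> set_homeo (U `*` [set: T]) [set: T] ->
  open A -> clopen D -> A `&` D `<=` set0 -> set_homeo A [set: T] ->
  set_homeo (A `|` D) [set: T].
Proof.
move=> cU Uz UT oA cD AD AT.
have hU : set_homeo [set: T] [set x : T | U (x 0%N)].
  apply: set_homeo_trans (set_homeo_sym UT) _.
  have := set_homeo_cons U [set: T].
  by congr set_homeo; apply/seteqP; split=> x /=; [case|].
have hz : set_homeo [set: T] [set x : T | x 0%N = z].
  apply: set_homeo_trans (set_homeo_sym (set_homeo_unit _ z)) _.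
  have := set_homeo_cons [set z] [set: T].
  by congr set_homeo; apply/seteqP; split=> x /=; [case|].
have cHead (V : set Y) : clopen V -> clopen [set x : T | V (x 0%N)].
  by move=> cV; apply: (preimage_clopen cV); exact: coord_continuous.
have [C [cC CU DC _]] := set_homeo_sub (cHead _ cU) cD (@subsetT _ _) hU.
have Cz x : C x -> x 0%N <> z by move=> /CU /= Ux xz; apply: Uz; rewrite -xz.
apply: set_homeo_trans _ (swindle z_clopen cC).
apply: set_homeoU => //; [exact: cD.1|exact: (cHead _ z_clopen).1|exact: cC.1| |].
  by move=> x [/= xz /Cz].
by apply: set_homeo_trans AT hz.
Qed.

(** The first coordinate is split off, the remaining box becomes the whole power by induction, and
    then the first factor is absorbed. *)
Lemma box_absorb (n : nat) (U : nat -> set Y) :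
  (forall j, set_homeo (U j `*` [set: T]) [set: T]) ->
  set_homeo (box n U) [set: T].
Proof.
elim: n U => [|n IH] U hU.
  rewrite (_ : box 0 U = setT); first exact: set_homeo_refl.
  by apply/seteqP; split.
apply: set_homeo_trans _ (hU 0%N).
apply: (@set_homeo_trans _ (Y * T)%type _ _ (U 0%N `*` box n (fun j => U j.+1))).
  apply: set_homeo_sym; have := set_homeo_cons (U 0%N) (box n (fun j => U j.+1)).
  congr set_homeo; apply/seteqP; split=> [x /= [Ux Bx] [|j] jn|x Bx] //.
    exact: Bx.
  by split=> [|j jn]; exact: Bx.
by apply: set_homeo_prod; [exact: set_homeo_refl|exact: IH].
Qed.

(** Every point of [Y] has small absorbed clopen neighbourhoods: [[set z]] at [z], and those of
    [factor_absorb] elsewhere. So [A] contains a clopen box homeomorphic to the power, and this box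
    absorbs the rest of [A]. *)
Lemma clopen_homeo_power (y : Y) (A : set T) :
  accessible_space Y -> (forall p : Y, clopen_base_at p) -> y <> z ->
  clopen A -> A !=set0 -> set_homeo A [set: T].
Proof.
move=> T1 bY yz cA [a Aa].
have absorb (p : Y) (V : set Y) : nbhs p V -> exists U,
    [/\ clopen U, U p, U `<=` V & set_homeo (U `*` [set: T]) [set: T]].
  move=> nV; have [pz|/eqP pz] := eqVneq p z.
    exists [set z]; split=> //; last exact: set_homeo_unit.
    by rewrite pz in nV; move=> y' ->; exact: nbhs_singleton.
  have [P [cP _ Pp bP]] := bY p.
  have [n PV] : exists n, P n `<=` V `&` ~` [set z].
    apply: bP; apply: filterI => //; apply: open_nbhs_nbhs; split=> //.
    exact: closed_openC z_clopen.2.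
  exists (P n); split=> //; first by move=> x /PV[].
  apply: (factor_absorb T1 z_clopen.1 (p := p)) => //.
  by move=> /PV[_]; exact.
have [U [cU Uy Uz UT]] : exists U,
    [/\ clopen U, U y, U `<=` ~` [set z] & set_homeo (U `*` [set: T]) [set: T]].
  apply: absorb; apply: open_nbhs_nbhs; split=> //.
  exact: closed_openC z_clopen.2.
have [n [V [nV VA]]] : exists n V, (forall j, nbhs (a j) (V j)) /\ box n V `<=` A.
  by apply: nbhs_boxP; apply: open_nbhs_nbhs; split=> //; exact: cA.1.
have /choice[W WP] j := absorb (a j) (V j) (nV j).
have cB : clopen (box n W) by apply: box_clopen => j; have [] := WP j.
rewrite (_ : A = box n W `|` (A `\` box n W)).
  apply: (absorb_clopen cU _ UT) => //.
  - by move=> /Uz; exact.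
  - exact: cB.1.
  - exact: clopenD.
  - by move=> x [Bx []].
  - by apply: box_absorb => j; have [] := WP j.
have BA : box n W `<=` A.
  by apply: subset_trans VA => x Bx j jn; have [_ _ WV _] := WP j; exact/WV/Bx.
apply/seteqP; split=> x; last by move=> [/BA|[]].
have [Bx _|nBx Ax] := pselect (box n W x); [by left|by right].
Qed.

Lemma power_h_homogeneous (y : Y) :
  accessible_space Y -> (forall p : Y, clopen_base_at p) -> y <> z ->
  h_homogeneous T.
Proof.
move=> T1 bY yz A B cA A0 cB B0; apply/homeomorphicP.
apply: set_homeo_trans (set_homeo_set_type cA.1 A0) _.
apply: set_homeo_trans _ (set_homeo_sym (set_homeo_set_type cB.1 B0)).
apply: set_homeo_trans (clopen_homeo_power T1 bY yz cA A0) _.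
exact: set_homeo_sym (clopen_homeo_power T1 bY yz cB B0).
Qed.

End HHomogeneous.

(** * Homeomorphisms of products and powers *)

Lemma homeomorphic_refl (S : topologicalType) : homeomorphic S S.
Proof. exact/homeomorphicP/set_homeo_refl. Qed.

Lemma homeomorphic_sym (S T : topologicalType) :
  homeomorphic S T -> homeomorphic T S.
Proof. by move=> /homeomorphicP h; exact/homeomorphicP/set_homeo_sym. Qed.

Lemma homeomorphic_trans (S T U : topologicalType) :
  homeomorphic S T -> homeomorphic T U -> homeomorphic S U.
Proof.
move=> /homeomorphicP h /homeomorphicP k; apply/homeomorphicP.
exact: set_homeo_trans h k.
Qed.

Lemma homeomorphic_prod (S T S' T' : topologicalType) :
  homeomorphic S S' -> homeomorphic T T' ->
  homeomorphic (S * T)%type (S' * T')%type.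
Proof.
move=> /homeomorphicP h /homeomorphicP k; apply/homeomorphicP.
by rewrite -!setXTT; exact: set_homeo_prod.
Qed.

Lemma homeomorphic_prodC (S T : topologicalType) :
  homeomorphic (S * T)%type (T * S)%type.
Proof.
have c (A B : topologicalType) : continuous (fun x : A * B => (x.2, x.1)).
  by move=> x; apply: continuous_pair; [exact: cvg_snd|exact: cvg_fst].
by exists (fun x => (x.2, x.1)), (fun x => (x.2, x.1)); split; by [exact: c|case].
Qed.

Lemma homeomorphic_prodA (S T U : topologicalType) :
  homeomorphic (S * (T * U))%type (S * T * U)%type.
Proof.
have cfst (A B : topologicalType) : continuous (fst : A * B -> A) by move=> x; exact: cvg_fst.
have csnd (A B : topologicalType) : continuous (snd : A * B -> B) by move=> x; exact: cvg_snd.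
have cA : continuous (fun x : S * (T * U) => ((x.1, x.2.1), x.2.2)).
  move=> x; apply: (@continuous_pair _ (S * T)%type U
    (fun x : S * (T * U) => (x.1, x.2.1)) (fun x => x.2.2)); last first.
    exact: continuous_compose (csnd _ _ x) (csnd _ _ _).
  apply: continuous_pair; first exact: cfst.
  exact: continuous_compose (csnd _ _ x) (cfst _ _ _).
have cA' : continuous (fun x : S * T * U => (x.1.1, (x.1.2, x.2))).
  move=> x; apply: (@continuous_pair _ S (T * U)%type
    (fun x : S * T * U => x.1.1) (fun x => (x.1.2, x.2))).
    exact: continuous_compose (cfst _ _ x) (cfst _ _ _).
  apply: continuous_pair; last exact: csnd.
  exact: continuous_compose (cfst _ _ x) (csnd _ _ _).
exists (fun x => ((x.1, x.2.1), x.2.2)), (fun x => (x.1.1, (x.1.2, x.2))).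
by split=> [[s [t u]]|[[s t] u]||].
Qed.

Lemma omega_map_continuous (S T : topologicalType) (f : S -> T) :
  continuous f ->
  continuous (fun x : omega_power S => (fun n => f (x n)) : omega_power T).
Proof.
move=> cf x; apply: omega_continuous => n.
exact: continuous_compose (@coord_continuous S n x) (cf _).
Qed.

Lemma omega_homeo (S T : topologicalType) :
  homeomorphic S T -> homeomorphic (omega_power S) (omega_power T).
Proof.
move=> [f [g [fK gK cf cg]]].
exists (fun x n => f (x n)), (fun x n => g (x n)); split.
- by move=> x; apply/funext => n; exact: fK.
- by move=> x; apply/funext => n; exact: gK.
- exact: omega_map_continuous.
- exact: omega_map_continuous.
Qed.

Lemma omega_prod (S T : topologicalType) :
  homeomorphic (omega_power (S * T)%type) (omega_power S * omega_power T)%type.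
Proof.
exists (fun x : omega_power (S * T)%type =>
    ((fun n => (x n).1) : omega_power S, (fun n => (x n).2) : omega_power T)),
  (fun x : omega_power S * omega_power T => fun n => (x.1 n, x.2 n)).
split.
- by move=> x; apply/funext => n; rewrite -surjective_pairing.
- by move=> [x y].
- move=> x; apply: continuous_pair; apply: omega_map_continuous => y.
    exact: cvg_fst.
  exact: cvg_snd.
- move=> x; apply: omega_continuous => n.
  apply: continuous_pair.
    have c1 : {for x, continuous (fst : omega_power S * omega_power T -> _)}.
      exact: cvg_fst.
    exact: continuous_compose c1 (@coord_continuous S n _).
  have c2 : {for x, continuous (snd : omega_power S * omega_power T -> _)}.
    exact: cvg_snd.
  exact: continuous_compose c2 (@coord_continuous T n _).
Qed.

Lemma omega_cons (S : topologicalType) :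
  homeomorphic (S * omega_power S)%type (omega_power S).
Proof.
apply/homeomorphicP; have := set_homeo_cons [set: S] [set: omega_power S].
by congr set_homeo; apply/seteqP; split.
Qed.

Lemma omega_omega (S : topologicalType) :
  homeomorphic (omega_power (omega_power S)) (omega_power S).
Proof.
have /card_set_bijP[f] := card_nat2; rewrite setTT_bijective => -[g fK gK].
have coord2 i j : continuous (fun x : omega_power (omega_power S) => x i j).
  move=> x; exact: continuous_compose (@coord_continuous _ i x) (@coord_continuous S j _).
exists (fun x n => x (g n).1 (g n).2), (fun x i j => x (f (i, j))); split.
- by move=> x; apply/funext => i; apply/funext => j; rewrite fK.
- by move=> x; apply/funext => n; rewrite -surjective_pairing gK.
- by move=> x; apply: omega_continuous => n; exact: coord2.
- move=> x; apply: omega_continuous => i; apply: omega_continuous => j.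
  exact: coord_continuous.
Qed.

Section OmegaFactor.
Variable X : topologicalType.
Local Notation T := (omega_power X).

Lemma omega_square : homeomorphic (T * T)%type T.
Proof.
apply: homeomorphic_trans _ (omega_omega X).
apply: homeomorphic_trans _ (omega_cons T).
apply: homeomorphic_prod; first exact: homeomorphic_refl.
exact/homeomorphic_sym/omega_omega.
Qed.

(** The hypothesis is raised to the power omega, and the power of [T] collapses back to [T]. *)
Lemma omega_strong_factor (F : topologicalType) :
  homeomorphic (F * T)%type T -> homeomorphic (omega_power F * T)%type T.
Proof.
move=> FT; apply: homeomorphic_trans (omega_omega X).
apply: homeomorphic_trans _ (omega_homeo FT).
apply: homeomorphic_trans _ (homeomorphic_sym (omega_prod _ _)).
apply: homeomorphic_prod; first exact: homeomorphic_refl.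
exact/homeomorphic_sym/omega_omega.
Qed.

(** Raising to the power omega displays [omega_power F] as a factor of [T], and that power absorbs
    one more copy of [F]. *)
Lemma omega_factor (F : topologicalType) (W : topologicalType) :
  homeomorphic (F * W)%type T -> homeomorphic (F * T)%type T.
Proof.
move=> FW; have h : homeomorphic (omega_power F * omega_power W)%type T.
  apply: homeomorphic_trans _ (omega_omega X).
  apply: homeomorphic_trans _ (omega_homeo FW).
  exact/homeomorphic_sym/omega_prod.
apply: (homeomorphic_trans _ h).
apply: homeomorphic_trans (homeomorphic_prod (homeomorphic_refl F) (homeomorphic_sym h)) _.
apply: homeomorphic_trans (homeomorphic_prodA _ _ _) _.
apply: homeomorphic_prod; [exact: omega_cons|exact: homeomorphic_refl].
Qed.

End OmegaFactor.

Lemma setXUT (S T : Type) (A B : set S) :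
  (A `|` B) `*` [set: T] = (A `*` setT) `|` (B `*` setT).
Proof.
apply/seteqP; split=> x; first by case=> -[]; [left|right].
by case=> -[]; split; [left| |right|].
Qed.

Lemma open_setXT (S T : topologicalType) (A : set S) :
  open A -> open (A `*` [set: T]).
Proof.
move=> oA; rewrite (_ : _ `*` _ = fst @^-1` A); last by apply/seteqP; split=> x // [].
by apply: open_comp => // x _; exact: cvg_fst.
Qed.

Lemma homeomorphic_two (S T : topologicalType) (A A' : set S) :
  open A -> open A' -> A `&` A' `<=` set0 -> A `|` A' = setT ->
  set_homeo A [set: T] -> set_homeo A' [set: T] ->
  homeomorphic (two_point_space * T)%type S.
Proof.
move=> oA oA' AA' AAT hA hA'; apply/homeomorphicP; rewrite -AAT.
have -> : [set: two_point_space * T] =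
    ([set true] `*` [set: T]) `|` ([set false] `*` [set: T]).
  by apply/seteqP; split=> // -[[] t] _; [left|right].
have ob (b : bool) : open ([set b] `*` [set: T] : set (two_point_space * T)).
  by apply: open_setXT; exact: discrete_open.
apply: set_homeoU => //.
- by move=> [b t] [[/= ->] _ []].
- apply: set_homeo_trans _ (set_homeo_sym hA); exact: set_homeo_unit.
- apply: set_homeo_trans _ (set_homeo_sym hA'); exact: set_homeo_unit.
Qed.

Lemma clopen_nbhs_tychonoff (T : topologicalType) :
  (forall (x : T) (U : set T), nbhs x U -> exists V, [/\ clopen V, V x & V `<=` U]) ->
  accessible_space T -> tychonoff_space T.
Proof.
move=> zT T1; split=> // a B cB nBa.
have [V [cV Va VB]] := zT a _ (open_nbhs_nbhs (conj (closed_openC cB) nBa)).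
pose f (x : T) : bool := `[< V x >].
(* The separating uniformity is pulled back from [bool] along the indicator of [V]; its entourage of
   pairs with equal indicator separates [a] from [B]. *)
pose T' : uniformType := initial_topology f.
exists (Uniform.class T'), [set xy | f xy.1 = f xy.2]; split.
- exists [set xy | xy.1 = xy.2]; last by case.
  by move=> _ [x _ <-].
- rewrite -subset0 => -[x y] [[/= -> By]] fxy.
  have : f y by rewrite -fxy; exact/asboolP.
  by move=> /asboolP /VB.
- move=> x U [W [[C oC <-] /= Cx] /filterS]; apply.
  have := clopen_near (x : T) cV; apply: filterS => y xy.
  by rewrite /preimage /= /f (propext xy).
Qed.

(** * Adjoining an isolated point *)

Section DisjointSum.
Variable X : topologicalType.
Local Notation sum := (disjoint_sum X one_point_space).
Let sum_family (b : bool) : topologicalType := if b then X else one_point_space.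

Definition sum_inl (x : X) : sum := existT sum_family true x.
Definition sum_inr : sum := existT sum_family false tt.

Lemma sum_inl_continuous : continuous sum_inl.
Proof. exact: (@existT_continuous _ sum_family true). Qed.

Lemma sum_casesE : range sum_inl `|` [set sum_inr] = setT.
Proof.
by apply/seteqP; split=> // -[[] x] _; [left; exists x|right; case: x].
Qed.

Lemma sum_disjoint : range sum_inl `&` [set sum_inr] `<=` set0.
Proof. by move=> _ [[x _ <-]]. Qed.

Lemma open_sum_inl (A : set X) : open A -> open (sum_inl @` A).
Proof. exact: (@existT_open_map _ sum_family true). Qed.

Lemma open_sum_inr : open [set sum_inr].
Proof.
have := @existT_open_map _ sum_family false setT openT.
by congr open; apply/seteqP; split=> [_ [[] _ <-]//|_ ->]; exists tt.
Qed.

Lemma sum_inrC : ~` [set sum_inr] = range sum_inl.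
Proof.
apply/seteqP; split=> [s sr|_ [x _ <-]//].
by have [|//] : (range sum_inl `|` [set sum_inr]) s by rewrite sum_casesE.
Qed.

Lemma clopen_sum_inr : clopen [set sum_inr].
Proof.
split; first exact: open_sum_inr.
by rewrite -openC sum_inrC; apply: open_sum_inl; exact: openT.
Qed.

Lemma clopen_sum_inl : clopen (range sum_inl).
Proof. by rewrite -sum_inrC; apply: (@clopenC _ _ set0); exact: clopen_sum_inr. Qed.

(** A left inverse of [sum_inl]; any value at the adjoined point keeps it continuous, as that point
    is isolated. *)
Definition sum_projl (x0 : X) (s : sum) : X :=
  let: existT b x := s in (if b return sum_family b -> X then id else fun=> x0) x.

Lemma sum_projl_continuous x0 : continuous (sum_projl x0).
Proof.
move=> [[] x] U nU; first exact: nU.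
have := open_nbhs_nbhs (conj open_sum_inr (erefl : [set sum_inr] sum_inr)).
have sub : [set sum_inr] `<=` sum_projl x0 @^-1` U.
  by move=> _ ->; exact: (nbhs_singleton nU).
by case: x nU => nU /(filterS sub).
Qed.

Lemma clopen_base_at_sum x : clopen_base_at x -> clopen_base_at (sum_inl x).
Proof.
move=> bx; apply: (@clopen_base_at_transfer X sum (sum_projl x) sum_inl
  (range sum_inl) (sum_inl x) clopen_sum_inl _ (@sum_projl_continuous x)
  (@sum_inl_continuous x) _ bx); first by exists x.
by move=> _ [y _ <-].
Qed.

Lemma accessible_sum : accessible_space X -> accessible_space sum.
Proof.
move=> T1; have inr_case (s : sum) : (exists x, s = sum_inl x) \/ s = sum_inr.
  have : (range sum_inl `|` [set sum_inr]) s by rewrite sum_casesE.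
  by move=> [[x _ <-]|->]; [left; exists x|right].
move=> s t; have [[x ->]|->] := inr_case s; have [[y ->]|->] := inr_case t => st.
- have /T1[A [oA xA yA]] : x != y by apply: contra st => /eqP ->.
  exists (sum_inl @` A); rewrite !inE; split; first exact: open_sum_inl.
    by exists x => //; exact: set_mem.
  move=> [y' Ay' /(congr1 (sum_projl x)) /= yy']; rewrite inE in yA.
  by apply: yA; rewrite -yy'.
- exists (range sum_inl); rewrite !inE; split; [exact: clopen_sum_inl.1|by exists x|].
  by move=> [].
- exists [set sum_inr]; rewrite !inE; split=> //; exact: open_sum_inr.
- by rewrite eqxx in st.
Qed.

Lemma clopen_nbhs_sum :
  (forall (x : X) (U : set X), nbhs x U -> exists V, [/\ clopen V, V x & V `<=` U]) ->
  forall (s : sum) (U : set sum), nbhs s U -> exists V, [/\ clopen V, V s & V `<=` U].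
Proof.
move=> zX s U nU.
have : (range sum_inl `|` [set sum_inr]) s by rewrite sum_casesE.
move=> [[x _ xs]|sr]; last first.
  rewrite sr in nU *; exists [set sum_inr]; split=> //; first exact: clopen_sum_inr.
  by move=> _ ->; exact: nbhs_singleton.
rewrite -xs in nU *.
have [V [cV Vx VU]] := zX x _ (near_preimage (@sum_inl_continuous x) nU).
exists (range sum_inl `&` sum_projl x @^-1` V); split.
- apply: clopenI; first exact: clopen_sum_inl.
  by apply: preimage_clopen => //; exact: sum_projl_continuous.
- by split=> //; exists x.
- by move=> _ [[y _ <-]] /= /VU.
Qed.

Lemma set_homeo_sum_inl (x0 : X) : set_homeo (range sum_inl) [set: X].
Proof.
exists (sum_projl x0), sum_inl; split=> [_ [x _ <-]|x _]; split=> //.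
Qed.

End DisjointSum.

(** The product with the sum splits into the product with [X], a copy of [S] by hypothesis, and
    another copy over the adjoined point. *)
Lemma sum_factor (X S : topologicalType) (x0 : X) :
  homeomorphic (X * S)%type S ->
  homeomorphic (two_point_space * S)%type (disjoint_sum X one_point_space * S)%type.
Proof.
move=> /homeomorphicP XS.
apply: (@homeomorphic_two _ _ (range (@sum_inl X) `*` setT)
  ([set sum_inr X] `*` setT)).
- exact/open_setXT/(clopen_sum_inl X).1.
- exact/open_setXT/open_sum_inr.
- by move=> [s t] [[/= sl _] [/= sr _]]; exact: (@sum_disjoint X s).
- by rewrite -setXUT sum_casesE setXTT.
- apply: set_homeo_trans _ XS; rewrite -setXTT.
  by apply: set_homeo_prod; [exact: set_homeo_sum_inl|exact: set_homeo_refl].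
- exact: set_homeo_unit.
Qed.

Lemma sum_omega_absorb (X : topologicalType) (x0 : X) :
  accessible_space X -> clopen_base_at x0 ->
  let Y := disjoint_sum X one_point_space in
  homeomorphic (X * omega_power Y)%type (omega_power Y).
Proof.
move=> T1 bX Y; apply/homeomorphicP.
have h : set_homeo (range (@sum_inl X) `*` [set: omega_power Y]) [set: omega_power Y].
  apply: (@factor_absorb _ (sum_inr X) (sum_inl x0)).
  - exact: accessible_sum.
  - exact: open_sum_inr.
  - exact: clopen_sum_inl.
  - by move=> [].
  - by exists x0.
  - exact: clopen_base_at_sum.
apply: set_homeo_trans _ h; rewrite -setXTT.
apply: set_homeo_prod; last exact: set_homeo_refl.
exact/set_homeo_sym/set_homeo_sum_inl.
Qed.

(** * The implications between the six conditions *)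

Section Equivalences.
Variable X : topologicalType.
Hypotheses (T1 : accessible_space X) (zX : zero_dimensional_space X)
  (fX : first_countable_space X).

Local Notation T := (omega_power X).

Lemma clopen_base_at_power (x : T) : clopen_base_at x.
Proof. by apply: clopen_base_at_omega => n; exact: clopen_base_at_first_countable. Qed.

Lemma accessible_omega (S : topologicalType) :
  accessible_space S -> accessible_space (omega_power S).
Proof.
move=> TS x y xy; have [n xyn] : exists n, x n != y n.
  apply: contrapT => h; case/eqP: xy; apply/funext => n.
  by apply: contrapT => /eqP xyn; apply: h; exists n.
have [A [oA xA yA]] := TS _ _ xyn.
exists ((fun x : omega_power S => x n) @^-1` A); split.
- by apply: open_comp => // z _; exact: coord_continuous.
- by rewrite inE; exact: set_mem.
- by rewrite inE in yA *.
Qed.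

(** Only [X] is assumed first-countable. Bases pass from the power of [X] to [Y] by way of the
    constant sequences in the power of [Y], with the first coordinate as retraction; then
    [power_h_homogeneous] is carried back to [T]. *)
Lemma h_homogeneous_of_isolated (Y : topologicalType) :
  (exists x y : X, x <> y) -> accessible_space Y -> isolated [set: Y] !=set0 ->
  homeomorphic T (omega_power Y) -> h_homogeneous T.
Proof.
move=> [x1 [x2 x12]] TY [z [_ [V nV]]]; rewrite setIT => Vz [f [g [fK gK cf cg]]].
have z_clopen : clopen [set z].
  split; last exact: accessible_closed_set1.
  by rewrite openE => y ->; rewrite /interior -Vz.
have [y yz] : exists y, y <> z.
  apply: contrapT => nY; apply: x12.
  have eqz (u : omega_power Y) : u = fun=> z.
    apply/funext => n; apply: contrapT => un; by apply: nY; exists (u n).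
  have := can_inj fK (etrans (eqz (f (fun=> x1))) (esym (eqz (f (fun=> x2))))).
  by move=> /(congr1 (fun u => u 0%N)).
have bY (p : Y) : clopen_base_at p.
  have cconst : continuous (fun q : Y => (fun=> q) : omega_power Y).
    by move=> q; apply: omega_continuous => n; exact: cvg_id.
  pose e (q : Y) : T := g (fun=> q).
  have ce : continuous e by move=> q; exact: continuous_compose (cconst q) (cg _).
  apply: (@clopen_base_at_transfer T Y e (fun x => f x 0%N) setT p clopenT I ce _ _
    (clopen_base_at_power (e p))).
    exact: continuous_compose (cf _) (@coord_continuous Y 0%N _).
  by move=> q _; rewrite /e gK.
have hY := power_h_homogeneous z_clopen TY bY yz.
have pull (A : set T) : clopen A -> set_homeo A (g @^-1` A).
  move=> cA; exists f, g; split=> [x Ax|u Au].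
    by split=> //; [rewrite /preimage/= fK|exact: cf].
  by split=> //; exact: cg.
move=> A B cA A0 cB B0.
have ne (C : set T) : C !=set0 -> g @^-1` C !=set0.
  by move=> [x Cx]; exists (f x); rewrite /preimage/= fK.
have cl (C : set T) : clopen C -> clopen (g @^-1` C).
  by move=> cC; exact: preimage_clopen.
have toset (C : set T) : clopen C -> C !=set0 ->
    homeomorphic (set_type C) (set_type (g @^-1` C)).
  move=> cC C0; apply/homeomorphicP.
  apply: set_homeo_trans (set_homeo_set_type cC.1 C0) _.
  apply: set_homeo_trans (pull C cC) _.
  exact/set_homeo_sym/(set_homeo_set_type (cl C cC).1 (ne C C0)).
apply: homeomorphic_trans (toset A cA A0) _.
apply: homeomorphic_trans _ (homeomorphic_sym (toset B cB B0)).
by apply: hY; [exact: cl|exact: ne|exact: cl|exact: ne].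
Qed.

Lemma strong_factor_two_of_h_homogeneous :
  (exists x y : X, x <> y) -> h_homogeneous T ->
  is_strong_factor two_point_space (set_type [set: T]).
Proof.
move=> [x [y xy]] hT.
have [V [cV Vx Vy]] : exists V, [/\ clopen V, V x & V `<=` ~` [set y]].
  apply: zero_dimensional_nbhs => //; apply: open_nbhs_nbhs; split=> //.
  exact/closed_openC/accessible_closed_set1.
pose C : set T := (fun u : T => u 0%N) @^-1` V.
have cC : clopen C by apply: preimage_clopen => //; exact: coord_continuous.
have cC' : clopen (~` C) by apply: (@clopenC _ _ set0).
have C0 : C !=set0 by exists (fun=> x).
have C'0 : ~` C !=set0 by exists (fun=> y) => /Vy; exact.
have T0 : [set: T] !=set0 by exists (fun=> x).
have all (A : set T) : clopen A -> A !=set0 -> set_homeo A [set: T].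
  move=> cA A0; apply: set_homeo_trans (set_homeo_sym (set_homeo_set_type cA.1 A0)) _.
  apply: set_homeo_trans _ (set_homeo_set_type openT T0).
  by apply/homeomorphicP/hT => //; exact: clopenT.
have h : homeomorphic (two_point_space * T)%type T.
  apply: (@homeomorphic_two _ _ C (~` C)) => //.
  - exact: cC.1.
  - exact: cC'.1.
  - by move=> u [].
  - by rewrite setUCr.
  - exact: all.
  - exact: all.
have hT' : homeomorphic (set_type [set: T]) T.
  exact/homeomorphicP/(set_homeo_set_type openT T0).
apply: homeomorphic_trans (homeomorphic_prod (homeomorphic_refl _) hT') _.
exact: homeomorphic_trans h (homeomorphic_sym hT').
Qed.

(** Doubling splits [C] into two clopen copies of itself. Replacing [C] by one of them, [B], and
    keeping the complement of [C] gives a copy of [S] that misses the other. *)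
Lemma proper_copy_of_strong_factor (S : topologicalType) (C : set S) :
  clopen C -> C !=set0 -> is_strong_factor two_point_space (set_type C) ->
  exists C' : set S, [/\ clopen C', C' <> setT & homeomorphic (set_type C') S].
Proof.
move=> cC C0 /homeomorphicP h; have hC := set_homeo_set_type cC.1 C0.
have {}h := set_homeo_trans h hC.
pose A : set (two_point_space * set_type C) := [set true] `*` setT.
have cA : clopen A.
  rewrite (_ : A = fst @^-1` [set true]); last by apply/seteqP; split=> x // [].
  apply: preimage_clopen; last by move=> x; exact: cvg_fst.
  by split; [exact: discrete_open|exact: discrete_closed].
have [B [cB BC AB AB']] := set_homeo_sub cC cA (@subsetT _ _) h.
have [c Cc] := C0; pose c' : set_type C := SigSub (mem_set Cc).
have B0 : B !=set0.
  have [f [g [fP _]]] := AB.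
  by have [//|Bf _ _] := fP (true, c'); exists (f (true, c')).
have [d [Cd nBd]] : C `\` B !=set0.
  have [f [g [fP _]]] := AB'.
  by have [|Bf _ _] := fP (false, c'); [split=> // -[]|exists (f (false, c'))].
have BCh : set_homeo B C.
  apply: set_homeo_trans (set_homeo_sym AB) _; apply: set_homeo_trans _ hC.
  exact: set_homeo_unit.
have cC' : clopen (~` C) by apply: (@clopenC _ _ set0).
exists (B `|` ~` C); split; first exact: clopenU.
  by move=> BT; have [//|/(_ Cd)] : (B `|` ~` C) d by rewrite BT.
apply/homeomorphicP.
have BC0 : B `|` ~` C !=set0 by case: B0 => b Bb; exists b; left.
apply: set_homeo_trans (set_homeo_set_type (clopenU cB cC').1 BC0) _.
rewrite -(setUCr C); apply: set_homeoU => //.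
- exact: cB.1.
- exact: cC'.1.
- exact: cC.1.
- exact: cC'.1.
- by move=> x [/BC].
- by move=> x [].
- exact: set_homeo_refl.
Qed.

Lemma one_point_tychonoff : tychonoff_space one_point_space.
Proof.
apply: clopen_nbhs_tychonoff => [x U nU|[] []]; last by rewrite eqxx.
exists [set x]; split=> [||_ -> //]; last exact: nbhs_singleton.
  by split; [exact: (@discrete_open (discrete_topology unit))
    |exact: (@discrete_closed (discrete_topology unit))].
by [].
Qed.

Lemma factor_of_copy (S : topologicalType) (C : set S) :
  homeomorphic (set_type C) S -> is_factor (set_type C) S.
Proof.
move=> CS; exists one_point_space; first exact: one_point_tychonoff.
apply: homeomorphic_trans (homeomorphic_prodC _ _) _.
apply: homeomorphic_trans _ CS; apply/homeomorphicP.
have := set_homeo_unit (set_type C) (tt : one_point_space).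
by congr set_homeo; apply/seteqP; split=> // -[[] c].
Qed.

Lemma sum_power_of_factor (C : set T) :
  clopen C -> C <> setT -> is_factor (set_type C) T ->
  homeomorphic T (omega_power (disjoint_sum X one_point_space)).
Proof.
move=> cC CT [W _ CW].
have cD : clopen (~` C) by apply: (@clopenC _ _ set0).
have [x0 Dx0] : ~` C !=set0.
  by apply/set0P/eqP => C0; apply: CT; rewrite -[C]setCK C0 setC0.
have D0 : ~` C !=set0 by exists x0.
pose D : topologicalType := set_type (~` C).
have [c _] : exists c : set_type C, True.
  by case: CW => _ [g _]; exists (g x0).1.
have C0 : C !=set0 by exists (val c); exact: set_valP.
have CTT := omega_factor CW.
have hD := set_homeo_set_type cD.1 D0.
have hC := set_homeo_set_type cC.1 C0.
pose d0 : D := SigSub (mem_set Dx0).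
pose Y : topologicalType := disjoint_sum D one_point_space.
have bD : clopen_base_at d0.
  have [f [g [fP gP]]] := hD.
  have cf : continuous f by move=> d; have [] := fP d I.
  apply: (clopen_base_at_transfer clopenT I cf _ _ (clopen_base_at_power (f d0)) (r := g)).
    by have [fd _ _] := fP d0 I; have [] := gP _ fd.
  by move=> d _; have [] := fP d I.
have TD : accessible_space D.
  move=> d e de; have [f [g [fP gP]]] := hD.
  have fde : f d != f e.
    apply: contra de => /eqP fde; have [_ <- _] := fP d I; have [_ <- _] := fP e I.
    by rewrite fde.
  have [A [oA dA eA]] := accessible_omega T1 fde.
  exists (f @^-1` A); rewrite !inE in dA eA *; split=> //.
  by apply: open_comp => // u _; have [] := fP u I.
(* The adjoined point makes [factor_absorb] available for [D], which may itself lack isolated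
   points. *)
have DY := sum_omega_absorb TD bD.
have two_Y : homeomorphic (two_point_space * omega_power Y)%type (omega_power Y).
  apply: homeomorphic_trans (sum_factor d0 DY) _; exact: omega_cons.
have YT : homeomorphic (Y * T)%type T.
  apply: homeomorphic_trans _ (omega_square X); apply/homeomorphicP.
  have -> : [set: Y * T] =
      (range (@sum_inl D) `*` [set: T]) `|` ([set sum_inr D] `*` [set: T]).
    by rewrite -setXUT sum_casesE setXTT.
  have -> : [set: T * T] = (~` C `*` [set: T]) `|` (C `*` [set: T]).
    by rewrite -setXUT setUC setUCr setXTT.
  apply: set_homeoU.
  - exact/open_setXT/(clopen_sum_inl D).1.
  - exact/open_setXT/open_sum_inr.
  - exact/open_setXT/cD.1.
  - exact/open_setXT/cC.1.
  - by move=> [s t] [[/= sl _] [/= sr _]]; exact: (@sum_disjoint D s).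
  - by move=> [s t] [[]] /= + _ [].
  - apply: set_homeo_prod; last exact: set_homeo_refl.
    exact: set_homeo_trans (set_homeo_sum_inl d0) hD.
  - apply: set_homeo_trans (set_homeo_unit _ _) _.
    apply: set_homeo_trans (set_homeo_sym (iffLR (homeomorphicP _ _) CTT)) _.
    rewrite -setXTT; apply: set_homeo_prod hC _; exact: set_homeo_refl.
have YTT := omega_strong_factor YT.
(* [T] has the factor [omega_power Y], which absorbs the two-point space. *)
have two_T : homeomorphic (two_point_space * T)%type T.
  apply: (homeomorphic_trans _ YTT).
  apply: homeomorphic_trans
    (homeomorphic_prod (homeomorphic_refl _) (homeomorphic_sym YTT)) _.
  apply: homeomorphic_trans (homeomorphic_prodA _ _ _) _.
  exact: homeomorphic_prod two_Y (homeomorphic_refl _).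
pose Y1 : topologicalType := disjoint_sum X one_point_space.
pose x1 : X := x0 0%N.
have Y1T : homeomorphic (Y1 * T)%type T.
  apply: homeomorphic_trans _ two_T; apply: homeomorphic_sym.
  by apply: sum_factor x1 _; exact: omega_cons.
(* The product of the powers of [X] and [Y1] collapses to the power of [Y1] here, and to [T] by
   [Y1T]; comparing the two finishes the proof. *)
have XY1 := omega_strong_factor (sum_omega_absorb T1
  (clopen_base_at_first_countable x1 zX fX)).
apply: homeomorphic_trans (homeomorphic_sym (omega_strong_factor Y1T)) _.
exact: homeomorphic_trans (homeomorphic_prodC _ _) XY1.
Qed.

Lemma tychonoff_sum : tychonoff_space (disjoint_sum X one_point_space).
Proof.
apply: clopen_nbhs_tychonoff; last exact: accessible_sum.
by apply: clopen_nbhs_sum => x U; exact: zero_dimensional_nbhs.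
Qed.

End Equivalences.

Theorem proposition24 (X : topologicalType)
  (X_tychonoff : tychonoff_space X)
  (X_zero_dimensional : zero_dimensional_space X)
  (X_first_countable : first_countable_space X)
  (X_two_points : exists x y : X, x <> y) :
  [<->
    homeomorphic (omega_power X)
      (omega_power (disjoint_sum X one_point_space));
    exists Y : topologicalType,
      [/\ tychonoff_space Y, isolated [set: Y] !=set0 &
          homeomorphic (omega_power X) (omega_power Y)];
    h_homogeneous (omega_power X);
    exists C : set (omega_power X),
      [/\ clopen C, C !=set0 & is_strong_factor two_point_space (set_type C)];
    exists C : set (omega_power X),
      [/\ clopen C, C <> [set: omega_power X] &
          homeomorphic (set_type C) (omega_power X)];
    exists C : set (omega_power X),
      [/\ clopen C, C <> [set: omega_power X] &
          is_factor (set_type C) (omega_power X)]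
  ].
Proof.
have [_ T1] := X_tychonoff; tfae.
- move=> h; exists (disjoint_sum X one_point_space); split=> //.
    exact: tychonoff_sum.
  exists (sum_inr X); split; first by rewrite inE.
  exists [set sum_inr X]; last by rewrite setIT.
  by apply: open_nbhs_nbhs; split=> //; exact: open_sum_inr.
- by move=> [Y [[_ TY] iY h]]; exact: h_homogeneous_of_isolated h.
- move=> h; exists setT; split; first exact: clopenT.
    by have [x _] := X_two_points; exists (fun=> x).
  exact: strong_factor_two_of_h_homogeneous.
- by move=> [C [cC C0 h]]; exact: proper_copy_of_strong_factor h.
- by move=> [C [cC CT h]]; exists C; split=> //; exact: factor_of_copy.
- by move=> [C [cC CT h]]; exact: sum_power_of_factor h.
Qed.
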